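(* $\mathcal{NMSO}_{\mathrm{ed}}=\mathcal{NGSM}_{\mathrm{fv}}\circ\mathcal{NGSM}_{\mathrm{fv}}$; that is, a string transduction $m$ has $\mathrm{ed}(m)$ a nondeterministic mso definable graph transduction if and only if $m$ is the composition of two transductions each realized by a finite visit 2gsm.
   Context: A 2gsm is $M=(Q,\Sigma_1,\Sigma_2,\delta,q_{in},q_f)$ with finite state set $Q$ and instructions $(p,\sigma,q_1,\alpha_1,\epsilon_1,q_0,\alpha_0,\epsilon_0)$, $p\neq q_f$, $\sigma\in\Sigma_1\cup\{\vdash,\dashv\}$, $\alpha_i\in\Sigma_2^*$, $\epsilon_i\in\{-1,0,+1\}$. On input $w$ the read-only tape is $\vdash w\dashv$ (positions $0..|w|+1$); start in $q_{in}$ at position 0; in state $p$ any instruction starting with $p$ may be executed: if the scanned symbol is $\sigma$, go to $q_1$, append $\alpha_1$ to the one-way output tape and move by $\epsilon_1$, else do the same with $(q_0,\alpha_0,\epsilon_0)$; the head may not leave the tape. $M$ realizes the relation of all $(w,z)$ such that some computation reaches $q_f$ having written $z$. A computation is $k$-visiting if each tape position is visited at most $k$ times; $M$ is finite visit if for some $k$ every pair in its relation has a $k$-visiting successful computation. $\mathcal{NGSM}_{\mathrm{fv}}$ is the family of transductions realized by finite visit 2gsm's. Composition: $R_1\circ R_2=\{(a,c)\mid\exists b:(a,b)\in R_1,(b,c)\in R_2\}$, extended to families elementwise. Graphs are $(V,E,\mathrm{lab})$ with $E\subseteq V\times\Gamma\times V$, $\mathrm{lab}:V\to\Sigma$; monadic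 second-order logic on graphs has node and node-set variables and atomic formulas $\mathrm{lab}_\sigma(x)$, $\mathrm{edge}_\gamma(x,y)$, $x=y$, $x\in X$. A nondeterministic mso definable graph transduction is given by a domain formula $\varphi_{\mathrm{dom}}$, a finite copy set $C$, node formulas $\varphi^c_\sigma(x)$ and edge formulas $\varphi^{c_1,c_2}_\gamma(x,y)$, with common free node-set variables (parameters); for each input $g$ and assignment of node sets to the parameters satisfying $\varphi_{\mathrm{dom}}$, the output has nodes $(u,c)$ for which exactly one $\sigma$ satisfies $\varphi^c_\sigma(u)$ (labelled $\sigma$) and edges $((u,c_1),\gamma,(v,c_2))$ between such nodes iff $\varphi^{c_1,c_2}_\gamma(u,v)$; the transduction is the relation of all such (input, output) pairs. For $w$ of length $k$, $\mathrm{ed}(w)$ has $k+1$ unlabelled nodes forming a path whose edges are labelled by the letters of $w$; $\mathrm{ed}(m)=\{(\mathrm{ed}(w),\mathrm{ed}(z))\mid(w,z)\in m\}$, and $\mathcal{NMSO}_{\mathrm{ed}}$ is the family of $m$ with $\mathrm{ed}(m)$ nondeterministic mso definable. *)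

(* Defs.v *)
From mathcomp Require Import all_boot.
Set Implicit Arguments.
Unset Strict Implicit.
Unset Printing Implicit Defensive.

Definition strans (A B : Type) := seq A -> seq B -> Prop.

Definition rcomp (A B C : Type) (R1 : strans A B) (R2 : strans B C) : strans A C :=
  fun a c => exists b, R1 a b /\ R2 b c.

Inductive tsym (S : Type) := LEnd | REnd | Sym of S.
Arguments LEnd {S}. Arguments REnd {S}.

Inductive dir := MLeft | MStay | MRight.

Record instr (Q S1 S2 : Type) := Instr {
  ins_p : Q; ins_sym : tsym S1;
  ins_q1 : Q; ins_a1 : seq S2; ins_e1 : dir;
  ins_q0 : Q; ins_a0 : seq S2; ins_e0 : dir }.

Record gsm (S1 S2 : finType) := Gsm {
  gQ : finType;
  q_in : gQ;
  q_f : gQ;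
  delta : seq (instr gQ S1 S2);
  delta_wf : all (fun i => ins_p i != q_f) delta }.

(* symbol at position i of the tape |- w -| (positions 0 .. |w|+1) *)
Definition tape (S : Type) (w : seq S) (i : nat) : tsym S :=
  if i is i'.+1 then (if drop i' w is a :: _ then Sym a else REnd) else LEnd.

(* propositional list membership (no decidable equality needed) *)
Fixpoint inseq (A : Type) (a : A) (s : seq A) : Prop :=
  if s is b :: s' then b = a \/ inseq a s' else False.

Definition moves (i : nat) (e : dir) (j : nat) : Prop :=
  match e with
  | MLeft => i = j.+1
  | MStay => j = i
  | MRight => j = i.+1
  end.

Section GsmSemantics.
Variables (S1 S2 : finType) (M : gsm S1 S2).

Definition conf := (gQ M * nat)%type.

Definition step (w : seq S1) (c c' : conf) (a : seq S2) : Prop :=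
  exists2 ins, inseq ins (delta M) &
    [/\ ins_p ins = c.1,
        (tape w c.2 = ins_sym ins /\
           [/\ c'.1 = ins_q1 ins, a = ins_a1 ins & moves c.2 (ins_e1 ins) c'.2])
        \/
        (tape w c.2 <> ins_sym ins /\
           [/\ c'.1 = ins_q0 ins, a = ins_a0 ins & moves c.2 (ins_e0 ins) c'.2])
      & c'.2 <= (size w).+1 ].

Inductive comp (w : seq S1) : conf -> seq conf -> seq S2 -> Prop :=
| comp0 c : comp w c [::] [::]
| compS c c' a cs z : step w c c' a -> comp w c' cs z -> comp w c (c' :: cs) (a ++ z).

Definition init_conf : conf := (q_in M, 0).

Definition successful (w : seq S1) (cs : seq conf) (z : seq S2) : Prop :=
  comp w init_conf cs z /\ (last init_conf cs).1 = q_f M.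

Definition gsm_rel : strans S1 S2 :=
  fun w z => exists cs, successful w cs z.

Definition k_visiting (k : nat) (cs : seq conf) : Prop :=
  forall i : nat, count (fun c : conf => c.2 == i) (init_conf :: cs) <= k.

Definition finite_visit : Prop :=
  exists k, forall w z, gsm_rel w z ->
    exists cs, successful w cs z /\ k_visiting k cs.

End GsmSemantics.

Definition NGSM_fv (S1 S2 : finType) (m : strans S1 S2) : Prop :=
  exists M : gsm S1 S2, finite_visit M /\ forall w z, m w z <-> gsm_rel M w z.

Record graph (Sg Gm : Type) := Graph {
  gV : finType;
  gE : gV -> Gm -> gV -> bool;
  glab : gV -> Sg }.
Arguments gV {Sg Gm} g.
Arguments gE {Sg Gm} g _ _ _.
Arguments glab {Sg Gm} g _.

Definition giso (Sg Gm : Type) (g h : graph Sg Gm) : Prop :=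
  exists f : gV g -> gV h, bijective f /\
    (forall v, glab h (f v) = glab g v) /\
    (forall u gm v, gE h (f u) gm (f v) = gE g u gm v).

(* MSO formulas; node variables and node-set variables are indexed by nat *)
Inductive mso (Sg Gm : Type) :=
| FLab of Sg & nat
| FEdge of Gm & nat & nat
| FEq of nat & nat
| FIn of nat & nat
| FNot of mso Sg Gm
| FAnd of mso Sg Gm & mso Sg Gm
| FOr of mso Sg Gm & mso Sg Gm
| FEx1 of nat & mso Sg Gm
| FEx2 of nat & mso Sg Gm.

Definition upd (A : Type) (f : nat -> A) (n : nat) (a : A) : nat -> A :=
  fun k => if k == n then a else f k.

(* satisfaction; unassigned node variables (None) make atoms false *)
Fixpoint sat (Sg Gm : Type) (g : graph Sg Gm) (nu1 : nat -> option (gV g))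
    (nu2 : nat -> gV g -> bool) (f : mso Sg Gm) : Prop :=
  match f with
  | FLab s x => if nu1 x is Some u then glab g u = s else False
  | FEdge gm x y =>
      match nu1 x, nu1 y with Some u, Some v => gE g u gm v | _, _ => False end
  | FEq x y =>
      match nu1 x, nu1 y with Some u, Some v => u = v | _, _ => False end
  | FIn x X => if nu1 x is Some u then nu2 X u else False
  | FNot f1 => ~ sat nu1 nu2 f1
  | FAnd f1 f2 => sat nu1 nu2 f1 /\ sat nu1 nu2 f2
  | FOr f1 f2 => sat nu1 nu2 f1 \/ sat nu1 nu2 f2
  | FEx1 x f1 => exists u, sat (upd nu1 x (Some u)) nu2 f1
  | FEx2 X f1 => exists U : gV g -> bool, sat nu1 (upd nu2 X U) f1
  end.

Definition asg0 (V : Type) : nat -> option V := fun _ => None.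
Definition asg1 (V : Type) (u : V) : nat -> option V :=
  fun k => if k == 0 then Some u else None.
Definition asg2 (V : Type) (u v : V) : nat -> option V :=
  fun k => if k == 0 then Some u else if k == 1 then Some v else None.

(* specification of a nondeterministic mso graph transduction from
   (Sg,Gm)-graphs to (Sg',Gm')-graphs.  Parameters are the free set variables;
   the free node variable of node formulas is 0, those of edge formulas 0,1. *)
Record mso_trans (Sg Gm Sg' Gm' : Type) := MsoTrans {
  copies : finType;
  phi_dom : mso Sg Gm;
  phi_node : copies -> Sg' -> mso Sg Gm;
  phi_edge : copies -> copies -> Gm' -> mso Sg Gm }.
Arguments copies {Sg Gm Sg' Gm'} m.
Arguments phi_dom {Sg Gm Sg' Gm'} m.
Arguments phi_node {Sg Gm Sg' Gm'} m _ _.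
Arguments phi_edge {Sg Gm Sg' Gm'} m _ _ _.

Section MsoSemantics.
Variables (Sg Gm Sg' Gm' : Type) (T : mso_trans Sg Gm Sg' Gm').

(* h is (isomorphic to) the output graph of T on g under parameters nu2 *)
Definition is_output (g : graph Sg Gm) (nu2 : nat -> gV g -> bool)
    (h : graph Sg' Gm') : Prop :=
  exists f : gV h -> (gV g * copies T)%type,
    [/\ injective f,
        (forall u c, (exists v, f v = (u, c)) <->
            exists! s, sat (asg1 u) nu2 (phi_node T c s)),
        (forall v, sat (asg1 (f v).1) nu2 (phi_node T (f v).2 (glab h v)))
      & (forall v v' gm, gE h v gm v' <->
            sat (asg2 (f v).1 (f v').1) nu2 (phi_edge T (f v).2 (f v').2 gm))].

Definition mso_rel (g : graph Sg Gm) (h : graph Sg' Gm') : Prop :=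
  exists nu2 : nat -> gV g -> bool,
    sat (asg0 (gV g)) nu2 (phi_dom T) /\ is_output nu2 h.

End MsoSemantics.

Definition ed (A : eqType) (w : seq A) : graph unit A :=
  @Graph unit A 'I_(size w).+1
    (fun u a v => (val v == (val u).+1) && (onth w (val u) == Some a))
    (fun _ => tt).

(* the family NMSO_ed: ed(m) is nondeterministic mso definable
   (graph relations taken up to isomorphism) *)
Definition NMSO_ed (S1 S2 : finType) (m : strans S1 S2) : Prop :=
  exists T : mso_trans unit S1 unit S2,
    (forall w z, m w z -> mso_rel T (ed w) (ed z)) /\
    (forall g h, mso_rel T g h ->
       exists w z, [/\ m w z, giso g (ed w) & giso h (ed z)]).

(* Main.v *)
(* Machines to logic: finite visit makes the visits of a computation nodes
   [(position, state, visit number)], so that the parameters can guess a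
   computation; its trace is an mso definable string and the written word is the
   image of the trace under a homomorphism. Nondeterministic mso definable
   transductions compose, by translating formulas backwards through the copies.

   Logic to machines: the first machine guesses the parameters and annotates every
   node with the states, before and after it, of automata that recognize the
   defining formulas on words with marked nodes. The second machine checks the
   annotation and then follows the output edges: walking from a node [u], it
   carries the state of the automaton with [u] marked and recognizes the target
   [v] from the annotation at [v]. On a checked annotation the output is unique,
   hence loops are silent and can be cut, which makes the machine finite visit. *)
From HB Require Import structures.
Require Import Defs.
From mathcomp Require Import all_boot.
From mathcomp Require Import boolp.
Set Implicit Arguments.
Unset Strict Implicit.
Unset Printing Implicit Defensive.

(** * Formulas, renaming and isomorphism *)

(** A machine that comes back to a position does not remember what it guessed there; the
    intermediate word fixes these guesses once. This is possible because a transduction mentions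
    finitely many set variables, so that a guess at a node fits into a letter. With the parameters
    fixed, the output is unique up to isomorphism, which makes the second machine realize a partial
    function. The automata read from left to right only. Hence what lies after a node is stored as a
    transition function, not as a state: it can be composed with letters to its left, and a walk to
    the left carries such a function. In this way both ends of an edge are tested with a single
    head. [NMSO_ed] speaks of arbitrary input graphs and of outputs that might fail to be paths. As
    paths are mso definable, everything is reduced to [string_mso], which only compares string
    graphs. *)

Section Formulas.
Variables (Sg Gm : Type).
Implicit Type f : mso Sg Gm.

(** One strict bound for the variables of both sorts, free and bound alike: it provides fresh
    variables in [ren] and the number of parameter bits in [nbits]. *)
Fixpoint vb f : nat :=
  match f with
  | FLab _ x => x.+1
  | FEdge _ x y | FEq x y | FIn x y => (maxn x y).+1
  | FNot f => vb f
  | FAnd f1 f2 | FOr f1 f2 => maxn (vb f1) (vb f2)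
  | FEx1 x f | FEx2 x f => maxn x.+1 (vb f)
  end.

Lemma sat_ext f (g : graph Sg Gm) nu1 nu1' (nu2 nu2' : nat -> gV g -> bool) :
  (forall x, x < vb f -> nu1 x = nu1' x) ->
  (forall X, X < vb f -> nu2 X =1 nu2' X) ->
  sat nu1 nu2 f <-> sat nu1' nu2' f.
Proof.
elim: f nu1 nu1' nu2 nu2' => [s x|c x y|x y|x X|f IH|f1 IH1 f2 IH2|f1 IH1 f2 IH2|x f IH|X f IH]
  nu1 nu1' nu2 nu2' /= H1 H2.
- by rewrite H1.
- by rewrite !H1 // ltnS leq_max leqnn ?orbT.
- by rewrite !H1 // ltnS leq_max leqnn ?orbT.
- rewrite H1 ?ltnS ?leq_max ?leqnn //; case: (nu1' x) => // u.
  by rewrite H2 // ltnS leq_max leqnn orbT.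
- by rewrite (IH _ _ _ _ H1 H2).
- by rewrite (IH1 _ nu1' _ nu2') ?(IH2 _ nu1' _ nu2') // => y Hy;
    rewrite ?H1 //; try (apply: H2); rewrite leq_max Hy ?orbT.
- by rewrite (IH1 _ nu1' _ nu2') ?(IH2 _ nu1' _ nu2') // => y Hy;
    rewrite ?H1 //; try (apply: H2); rewrite leq_max Hy ?orbT.
- suff E u : sat (upd nu1 x (Some u)) nu2 f <-> sat (upd nu1' x (Some u)) nu2' f.
    by split=> -[u /E Hu]; exists u.
  apply: IH => y Hy; last by apply: H2; rewrite leq_max Hy orbT.
  by rewrite /upd; case: eqP => // _; apply: H1; rewrite leq_max Hy orbT.
- suff E U : sat nu1 (upd nu2 X U) f <-> sat nu1' (upd nu2' X U) f.
    by split=> -[u /E Hu]; exists u.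
  apply: IH => y Hy; first by apply: H1; rewrite leq_max Hy orbT.
  by rewrite /upd; case: eqP => // _; apply: H2; rewrite leq_max Hy orbT.
Qed.

Lemma sat_eqfun f (g : graph Sg Gm) nu1 nu1' (nu2 nu2' : nat -> gV g -> bool) :
  nu1 =1 nu1' -> (forall X, nu2 X =1 nu2' X) ->
  sat nu1 nu2 f <-> sat nu1' nu2' f.
Proof. by move=> H1 H2; apply: sat_ext. Qed.

Definition fresh (r : nat -> nat) n := (\max_(k < n) r k).+1.

Lemma fresh_gt r n k : k < n -> r k < fresh r n.
Proof. by move=> kn; rewrite ltnS (leq_bigmax (Ordinal kn)). Qed.

(** Bound variables are sent beyond the images of all variables of the body, so that [sat_ren] holds
    even for non-injective renamings. Later ones collapse all irrelevant variables to one unassigned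
    index. *)
Fixpoint ren (r1 r2 : nat -> nat) f : mso Sg Gm :=
  match f with
  | FLab s x => FLab Gm s (r1 x)
  | FEdge c x y => FEdge Sg c (r1 x) (r1 y)
  | FEq x y => FEq Sg Gm (r1 x) (r1 y)
  | FIn x X => FIn Sg Gm (r1 x) (r2 X)
  | FNot f => FNot (ren r1 r2 f)
  | FAnd f1 f2 => FAnd (ren r1 r2 f1) (ren r1 r2 f2)
  | FOr f1 f2 => FOr (ren r1 r2 f1) (ren r1 r2 f2)
  | FEx1 x f => let y := fresh r1 (vb f) in FEx1 y (ren (upd r1 x y) r2 f)
  | FEx2 X f => let Y := fresh r2 (vb f) in FEx2 Y (ren r1 (upd r2 X Y) f)
  end.

Lemma sat_ren f r1 r2 (g : graph Sg Gm) nu1 (nu2 : nat -> gV g -> bool) :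
  sat nu1 nu2 (ren r1 r2 f) <-> sat (nu1 \o r1) (nu2 \o r2) f.
Proof.
elim: f r1 r2 nu1 nu2 => [s x|c x y|x y|x X|f IH|f1 IH1 f2 IH2|f1 IH1 f2 IH2|x f IH|X f IH]
  r1 r2 nu1 nu2 //=.
- by rewrite IH.
- by rewrite IH1 IH2.
- by rewrite IH1 IH2.
- suff E u : sat (upd nu1 (fresh r1 (vb f)) (Some u)) nu2 (ren (upd r1 x (fresh r1 (vb f))) r2 f)
             <-> sat (upd (nu1 \o r1) x (Some u)) (nu2 \o r2) f.
    by split=> -[u /E Hu]; exists u.
  rewrite IH; apply: sat_ext => //= y Hy; rewrite /upd.
  case: (y =P x) => [_|_]; rewrite ?eqxx //.
  by have := fresh_gt r1 Hy; rewrite ltn_neqAle => /andP[/negbTE->].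
- suff E U : sat nu1 (upd nu2 (fresh r2 (vb f)) U) (ren r1 (upd r2 X (fresh r2 (vb f))) f)
             <-> sat (nu1 \o r1) (upd (nu2 \o r2) X U) f.
    by split=> -[U /E HU]; exists U.
  rewrite IH; apply: sat_ext => //= y Hy; rewrite /upd.
  case: (y =P X) => [_|_]; rewrite ?eqxx //.
  by have := fresh_gt r2 Hy; rewrite ltn_neqAle => /andP[/negbTE->].
Qed.

(** The syntax has no constants; a formula and its negation are contradictory whether or not
    variable 0 is assigned. *)
Definition FFalse : mso Sg Gm := let f := FEq Sg Gm 0 0 in FAnd f (FNot f).
Definition FAll1 x f := FNot (FEx1 x (FNot f)).
Definition FAll2 x f := FNot (FEx2 x (FNot f)).
Definition FImp f1 f2 := FOr (FNot f1) f2.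
Definition FBool (b : bool) := if b then FNot FFalse else FFalse.
Definition FOrs (I : finType) (F : I -> mso Sg Gm) := foldr (fun i => FOr (F i)) FFalse (enum I).
Definition FAnds (I : finType) (F : I -> mso Sg Gm) := FNot (FOrs (fun i => FNot (F i))).

Variables (g : graph Sg Gm).

Lemma sat_And nu1 (nu2 : nat -> gV g -> bool) f1 f2 :
  sat nu1 nu2 (FAnd f1 f2) <-> sat nu1 nu2 f1 /\ sat nu1 nu2 f2.
Proof. by []. Qed.

Lemma sat_Or nu1 (nu2 : nat -> gV g -> bool) f1 f2 :
  sat nu1 nu2 (FOr f1 f2) <-> sat nu1 nu2 f1 \/ sat nu1 nu2 f2.
Proof. by []. Qed.

Lemma sat_Not nu1 (nu2 : nat -> gV g -> bool) f : sat nu1 nu2 (FNot f) <-> ~ sat nu1 nu2 f.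
Proof. by []. Qed.

Lemma sat_Ex1 nu1 (nu2 : nat -> gV g -> bool) x f :
  sat nu1 nu2 (FEx1 x f) <-> exists u, sat (upd nu1 x (Some u)) nu2 f.
Proof. by []. Qed.

Lemma sat_False nu1 (nu2 : nat -> gV g -> bool) : sat nu1 nu2 FFalse <-> False.
Proof. by split=> //= -[]. Qed.

Lemma sat_Bool nu1 (nu2 : nat -> gV g -> bool) b : sat nu1 nu2 (FBool b) <-> b.
Proof. by case: b; rewrite /= ; split=> //; [move=> _ []|case]. Qed.

Lemma sat_All1 nu1 (nu2 : nat -> gV g -> bool) x f :
  sat nu1 nu2 (FAll1 x f) <-> forall u, sat (upd nu1 x (Some u)) nu2 f.
Proof.
split=> /= [H u|H [u Hu]]; last exact: Hu.
by apply: contrapT => Hu; apply: H; exists u.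
Qed.

Lemma sat_All2 nu1 (nu2 : nat -> gV g -> bool) x f :
  sat nu1 nu2 (FAll2 x f) <-> forall u, sat nu1 (upd nu2 x u) f.
Proof.
split=> /= [H u|H [u Hu]]; last exact: Hu.
by apply: contrapT => Hu; apply: H; exists u.
Qed.

Lemma sat_Imp nu1 (nu2 : nat -> gV g -> bool) f1 f2 :
  sat nu1 nu2 (FImp f1 f2) <-> (sat nu1 nu2 f1 -> sat nu1 nu2 f2).
Proof.
split=> /= [[]//|H]; case: (pselect (sat nu1 nu2 f1)); [right|left] => //; exact: H.
Qed.

Lemma sat_Ors nu1 (nu2 : nat -> gV g -> bool) (I : finType) F :
  sat nu1 nu2 (FOrs F) <-> exists i : I, sat nu1 nu2 (F i).
Proof.
rewrite /FOrs; suff -> : sat nu1 nu2 (foldr (fun i => FOr (F i)) FFalse (enum I)) <->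
  exists2 i : I, i \in enum I & sat nu1 nu2 (F i).
  by split=> [[i _]|[i]]; exists i => //; rewrite mem_enum.
elim: (enum I) => [|i s IH]; first by rewrite sat_False; split=> // -[i].
rewrite [foldr _ _ _]/=; split=> [/= [H|/IH[j js H]]|[j]].
- by exists i; rewrite ?mem_head.
- by exists j; rewrite // inE js orbT.
- rewrite inE => /predU1P[->|js] H; first by left.
  by right; apply/IH; exists j.
Qed.

Lemma sat_Ands nu1 (nu2 : nat -> gV g -> bool) (I : finType) F :
  sat nu1 nu2 (FAnds F) <-> forall i : I, sat nu1 nu2 (F i).
Proof.
rewrite /FAnds [sat _ _ (FNot _)]/= sat_Ors; split=> [H i|H [i]]; last by move=> nFi; apply: nFi; exact: H.
by apply: contrapT => Hi; apply: H; exists i.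
Qed.

End Formulas.
Arguments FFalse {Sg Gm}.
Arguments FBool {Sg Gm}.

Lemma sat_iso Sg Gm (g h : graph Sg Gm) (e : gV g -> gV h) f nu1 nu1' nu2 nu2' :
  bijective e ->
  (forall v, glab h (e v) = glab g v) ->
  (forall u c v, gE h (e u) c (e v) = gE g u c v) ->
  (forall x, nu1' x = omap e (nu1 x)) -> (forall X u, nu2' X (e u) = nu2 X u) ->
  sat nu1 nu2 f <-> sat nu1' nu2' f.
Proof.
move=> eb el eE; have [e' eK e'K] := eb; have ei := bij_inj eb.
elim: f nu1 nu1' nu2 nu2' => [s x|c x y|x y|x X|f IH|f1 IH1 f2 IH2|f1 IH1 f2 IH2|x f IH|X f IH]
  nu1 nu1' nu2 nu2' H1 H2 /=; rewrite ?H1.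
- by case: (nu1 x) => //= u; rewrite el.
- by case: (nu1 x) => //= u; case: (nu1 y) => //= v; rewrite eE.
- by case: (nu1 x) => //= u; case: (nu1 y) => //= v; split=> [->//|/ei].
- by case: (nu1 x) => //= u; rewrite H2.
- by rewrite (IH _ nu1' _ nu2').
- by rewrite (IH1 _ nu1' _ nu2') // (IH2 _ nu1' _ nu2').
- by rewrite (IH1 _ nu1' _ nu2') // (IH2 _ nu1' _ nu2').
- split=> -[u Hu]; [exists (e u)|exists (e' u)]; move: Hu; apply IH => // y; rewrite /upd;
    by case: eqP => //= _; rewrite e'K.
- split=> -[U Hu]; [exists (U \o e')|exists (U \o e)]; move: Hu; apply IH => // Y u; rewrite /upd;
    by case: eqP => //= _; rewrite ?eK.
Qed.

Lemma giso_sym Sg Gm (g h : graph Sg Gm) : giso g h -> giso h g.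
Proof.
move=> [e [[e' eK e'K] [el eE]]]; exists e'; split; first by exists e.
by split=> [v|u c v]; rewrite -?el -?eE !e'K.
Qed.

Lemma giso_refl Sg Gm (g : graph Sg Gm) : giso g g.
Proof. by exists id; split=> //; exists id. Qed.

Section UnitOutput.
Variables (Sg Gm Gm' : Type) (T : mso_trans Sg Gm unit Gm').

(** With labels in [unit], the unique existence of a label collapses to satisfaction of one formula,
    and the embedding [F] alone describes the output. *)
Definition outby (g : graph Sg Gm) (nu2 : nat -> gV g -> bool) (h : graph unit Gm')
    (F : gV h -> gV g * copies T) : Prop :=
  [/\ injective F,
      forall u c, (exists v, F v = (u, c)) <-> sat (asg1 u) nu2 (phi_node T c tt)
    & forall v v' gm, gE h v gm v' <->
            sat (asg2 (F v).1 (F v').1) nu2 (phi_edge T (F v).2 (F v').2 gm)].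

Lemma is_outputP g nu2 (h : graph unit Gm') :
  is_output T (g := g) nu2 h <-> exists F, outby nu2 (h := h) F.
Proof.
have ex1 (P : unit -> Prop) : (exists! s, P s) <-> P tt.
  by split=> [[[] []]//|H]; exists tt; split=> // -[].
split=> [[F [F1 F2 F3 F4]]|[F [F1 F2 F3]]]; exists F.
  by split=> // u c; rewrite F2 ex1.
split=> // [u c|v]; first by rewrite ex1.
by case: (glab h v); apply/F2; exists v; case: (F v).
Qed.

Lemma mso_rel_iso (g g' : graph Sg Gm) (h h' : graph unit Gm') :
  giso g g' -> giso h h' -> mso_rel T g h -> mso_rel T g' h'.
Proof.
move=> [e [eb [el eE]]] /giso_sym[k [kb [kl kE]]] [nu2 [dom /is_outputP[F [F1 F2 F3]]]].
have [e' eK e'K] := eb; have [k' kK k'K] := kb.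
pose nu2' X u := nu2 X (e' u).
have S nu1 nu1' f : (forall x, nu1' x = omap e (nu1 x)) -> sat nu1 nu2 f <-> sat nu1' nu2' f.
  by move=> H1; apply: (sat_iso (e := e)) => // X u; rewrite /nu2' eK.
exists nu2'; split; first by move: dom; apply S.
apply/is_outputP; exists (fun v => (e (F (k v)).1, (F (k v)).2)); split.
- move=> u v [/(bij_inj eb) E1 E2]; apply/(bij_inj kb)/F1.
  by move: E1 E2; case: (F _) => ? ? /=; case: (F _) => ? ? /= -> ->.
- move=> u c; rewrite -(S (asg1 (e' u))) => [|x]; last first.
    by rewrite /asg1; case: eqP => //= _; rewrite e'K.
  rewrite -F2; split=> -[v]; last by move=> H; exists (k' v); rewrite k'K H /= e'K.
  by case E: (F _) => [a b] /= [<- <-]; exists (k v); rewrite eK.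
- move=> v v' gm /=; rewrite -kE F3; apply: S => x; rewrite /asg2.
  by case: eqP => // _; case: eqP.
Qed.

End UnitOutput.

(** * Backward translation and composition of transductions *)

Section Ex2s.
Variables (Sg Gm : Type) (C : eqType) (key : C -> nat).

(** A set of output nodes is a family of sets of input nodes, one for each copy; it is quantified as
    a block. *)
Definition FEx2s (s : seq C) (f : mso Sg Gm) := foldr (fun c => FEx2 (key c)) f s.

Lemma sat_FEx2s_elim s f (g : graph Sg Gm) nu1 (nu2 : nat -> gV g -> bool) :
  sat nu1 nu2 (FEx2s s f) ->
  exists2 nu2', sat nu1 nu2' f & forall k, (forall c, k != key c) -> nu2' k = nu2 k.
Proof.
elim: s nu2 => [|c s IH] nu2 /=; first by exists nu2.
by case=> U /IH[nu2' H E]; exists nu2' => // k Hk; rewrite E // /upd (negbTE (Hk c)).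
Qed.

Lemma sat_FEx2s_intro s f (g : graph Sg Gm) nu1 (nu2 nu2' : nat -> gV g -> bool) :
  sat nu1 nu2' f -> (forall k, (forall c, c \in s -> k != key c) -> nu2' k =1 nu2 k) ->
  sat nu1 nu2 (FEx2s s f).
Proof.
move=> H; elim: s nu2 => [|c s IH] nu2 E /=; first by move: H; apply sat_eqfun => // X u; rewrite E.
exists (nu2' (key c)); apply: IH => k Hk; rewrite /upd; case: eqP => [->//|/eqP kc].
by apply: E => d; rewrite inE => /predU1P[->|/Hk].
Qed.

End Ex2s.

Section Back.
Variables (Sg A B : Type) (T : mso_trans Sg A unit B).
Local Notation C := (copies T).

(** Two disjoint families of set variables: the parameters of [T], and the trace of each output set
    variable on each copy. *)
Definition kpar (p : nat) : nat := pickle (inl p : nat + nat * C).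
Definition kset (X : nat) (c : C) : nat := pickle (inr (X, c) : nat + nat * C).

Lemma kpar_kset p X c : (kpar p == kset X c) = false.
Proof. by apply/eqP => /(pcan_inj pickleK). Qed.

Lemma kset_inj X c Y d : (kset X c == kset Y d) = (X == Y) && (c == d).
Proof. by rewrite (inj_eq (pcan_inj pickleK)). Qed.

(* Node variable [x] of the output graph becomes the node variable [x.+1] of
   the input graph, its copy being recorded in [k]; variable [0] stays
   unassigned, to stand for the unassigned variables of the formulas of [T]. *)
Fixpoint back (k : nat -> option C) (f : mso unit B) : mso Sg A :=
  match f with
  | FLab _ x => FBool (k x != None)
  | FEdge b x y => if (k x, k y) is (Some c, Some d) then
      ren (fun i => if i == 0 then x.+1 else if i == 1 then y.+1 else 0) kpar
        (phi_edge T c d b)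
      else FFalse
  | FEq x y => if (k x, k y) is (Some c, Some d) then
      if c == d then FEq Sg A x.+1 y.+1 else FFalse else FFalse
  | FIn x X => if k x is Some c then FIn Sg A x.+1 (kset X c) else FFalse
  | FNot f => FNot (back k f)
  | FAnd f1 f2 => FAnd (back k f1) (back k f2)
  | FOr f1 f2 => FOr (back k f1) (back k f2)
  | FEx1 x f => FOrs (fun c : C => FEx1 x.+1
      (FAnd (ren (fun i => if i == 0 then x.+1 else 0) kpar (phi_node T c tt))
            (back (upd k x (Some c)) f)))
  | FEx2 X f => FEx2s (kset X) (enum C) (back k f)
  end.

(** An output node [v] is represented by the input node [(F v).1] and the copy [(F v).2].
    Injectivity of [F] allows equality, and sets of output nodes, to be read off copy by copy. *)
Lemma sat_back (g : graph Sg A) (h : graph unit B) F par f k nu1 nu2 nuh1 nuh2 :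
  outby (T := T) (g := g) par (h := h) F ->
  (forall p, nu2 (kpar p) =1 par p) ->
  nu1 0 = None ->
  (forall x, match k x with
     | Some c => exists v, [/\ nuh1 x = Some v, (F v).2 = c & nu1 x.+1 = Some (F v).1]
     | None => nuh1 x = None end) ->
  (forall X v, nuh2 X v = nu2 (kset X (F v).2) (F v).1) ->
  sat nu1 nu2 (back k f) <-> sat nuh1 nuh2 f.
Proof.
move=> [F1 F2 F3].
elim: f k nu1 nu2 nuh1 nuh2 => [[] x|b x y|x y|x X|f IH|f1 IH1 f2 IH2|f1 IH1 f2 IH2|x f IH|X f IH]
  k nu1 nu2 nuh1 nuh2 Hp H0 H1 H2.
- rewrite sat_Bool /=; have := H1 x; case: (k x) => [c [v [-> _ _]]|->] //=.
  by case: (glab h v).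
- rewrite /=; have := H1 x; case: (k x) => [c [v [-> <- Ev]]|->]; last by rewrite sat_False.
  have := H1 y; case: (k y) => [d [v' [-> <- Ev']]|->]; last by rewrite sat_False.
  rewrite sat_ren F3; apply: sat_eqfun => // i; rewrite /asg2 /=.
  by case: eqP => // _; case: eqP.
- rewrite /=; have := H1 x; case: (k x) => [c [v [-> <- Ev]]|->]; last by rewrite sat_False.
  have := H1 y; case: (k y) => [d [v' [-> <- Ev']]|->]; last by rewrite sat_False.
  case: eqP => [E|E] /=; last by split=> [[]//|vv]; case: E; rewrite vv.
  rewrite Ev Ev'; split=> [E'|->//]; apply: F1.
  by move: E E'; case: (F v) => ? ?; case: (F v') => ? ? /= -> ->.
- rewrite /=; have := H1 x; case: (k x) => [c [v [-> <- Ev]]|->]; last by rewrite sat_False.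
  by rewrite /= Ev H2.
- by rewrite /= (IH _ _ _ nuh1 nuh2).
- by rewrite /= (IH1 _ _ _ nuh1 nuh2) // (IH2 _ _ _ nuh1 nuh2).
- by rewrite /= (IH1 _ _ _ nuh1 nuh2) // (IH2 _ _ _ nuh1 nuh2).
- rewrite [back _ _]/= sat_Ors /=.
  have N c u : sat (upd nu1 x.+1 (Some u)) nu2
      (ren (fun i => if i == 0 then x.+1 else 0) kpar (phi_node T c tt)) <->
      exists v, F v = (u, c).
    rewrite sat_ren F2; apply: sat_eqfun => // i; rewrite /asg1 /upd /=.
    by case: (i == 0); rewrite ?eqxx.
  have S v : sat (upd nu1 x.+1 (Some (F v).1)) nu2 (back (upd k x (Some (F v).2)) f) <->
      sat (upd nuh1 x (Some v)) nuh2 f.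
    apply: IH => // y; rewrite /upd eqSS; case: eqP => _; first by exists v.
    exact: H1.
  split=> [[c [u [/N[v Ev] H]]]|[v /S H]].
    by exists v; apply/S; rewrite Ev.
  by exists (F v).2, (F v).1; split=> //; apply/N; exists v; case: (F v).
- rewrite [back _ _]/= /=; split=> [/sat_FEx2s_elim[nu2' H E]|[U H]].
    exists (fun v => nu2' (kset X (F v).2) (F v).1); move: H; apply IH => //.
      by move=> p u; rewrite E ?Hp // => c; rewrite kpar_kset.
    move=> Y v; rewrite /upd; case: eqP => [->//|/eqP YX].
    by rewrite H2 E // => c; rewrite kset_inj (negbTE YX).
  (* The variables [kset X c] receive the traces of [U]; all others keep their values, in particular
     the parameters of [T]. *)
  pose nu2' q u := if [pick c | q == kset X c] is Some c
    then `[< exists2 v, F v = (u, c) & U v >] else nu2 q u.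
  apply: (sat_FEx2s_intro (nu2' := nu2')); last first.
    move=> q Hq u; rewrite /nu2'; case: pickP => // c /eqP E.
    by have := Hq c; rewrite mem_enum E eqxx => /(_ isT).
  move: H; apply IH => //.
    move=> p u; rewrite /nu2' -Hp; case: pickP => // c.
    by rewrite kpar_kset.
  move=> Y v; rewrite /upd /nu2'; case: pickP => [c|Hn].
    rewrite kset_inj => /andP[/eqP-> /eqP <-]; rewrite eqxx.
    apply/idP/asboolP => [Uv|[v' E]]; first by exists v => //; case: (F v).
    by rewrite (F1 v v') // E; case: (F v).
  case: eqP => [E|_]; last exact: H2.
  by have := Hn (F v).2; rewrite E eqxx.
Qed.

(** Undoes the shift of [back], to return to the conventions of [asg1] and [asg2]; the unassigned
    variable becomes 2. *)
Definition btop k f := ren (fun i => if i == 1 then 0 else if i == 2 then 1 else 2) id (back k f).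

Section BTop.
Variables (g : graph Sg A) (h : graph unit B) (F : gV h -> gV g * C)
  (par : nat -> gV g -> bool) (nu2 : nat -> gV g -> bool) (nuh2 : nat -> gV h -> bool).
Hypotheses (HF : outby (T := T) (g := g) par (h := h) F)
  (Hp : forall p, nu2 (kpar p) =1 par p)
  (H2 : forall X v, nuh2 X v = nu2 (kset X (F v).2) (F v).1).

Lemma sat_btop0 f : sat (@asg0 _) nu2 (btop (@asg0 _) f) <-> sat (@asg0 _) nuh2 f.
Proof. by rewrite sat_ren; apply: sat_back HF _ _ _ _. Qed.

Lemma sat_btop1 f v :
  sat (asg1 (F v).1) nu2 (btop (asg1 (F v).2) f) <-> sat (asg1 v) nuh2 f.
Proof.
rewrite sat_ren; apply: sat_back HF _ _ _ _ => // x.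
rewrite /asg1; case: x => [|[|x]] //=; by exists v.
Qed.

Lemma sat_btop2 f v v' :
  sat (asg2 (F v).1 (F v').1) nu2 (btop (asg2 (F v).2 (F v').2) f) <-> sat (asg2 v v') nuh2 f.
Proof.
rewrite sat_ren; apply: sat_back HF _ _ _ _ => // x.
rewrite /asg2; case: x => [|[|x]] //=; by [exists v|exists v'].
Qed.

End BTop.

(** A canonical output for arbitrary parameters; it serves as the intermediate graph of a
    composition. *)
Definition outgraph (g : graph Sg A) (nu2 : nat -> gV g -> bool) : graph unit B :=
  @Graph unit B {x : gV g * C | `[< sat (asg1 x.1) nu2 (phi_node T x.2 tt) >]}
    (fun u b v => `[< sat (asg2 (val u).1 (val v).1) nu2 (phi_edge T (val u).2 (val v).2 b) >])
    (fun _ => tt).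

Lemma outgraphP (g : graph Sg A) (nu2 : nat -> gV g -> bool) :
  outby (T := T) nu2 (h := outgraph nu2) val.
Proof.
split; first exact: val_inj.
  move=> u c; split=> [[[x Hx] /= E]|H]; first by move: Hx; rewrite E => /asboolP.
  by have /asboolP H' := H; exists (Sub (u, c) H').
by move=> v v' b; split=> /asboolP.
Qed.

End Back.

Arguments back {Sg A B} T k f.
Arguments btop {Sg A B} T k f.
Arguments kset {Sg A B} T X c.

Section Comp.
Variables (Sg A B D : Type) (T1 : mso_trans Sg A unit B) (T2 : mso_trans unit B unit D).

(** The parameters of the composite are those of [T1], under [kpar], and the traces on the copies of
    [T1] of those of [T2], under [kset]. *)
Definition mso_comp : mso_trans Sg A unit D :=
  @MsoTrans Sg A unit D (copies T1 * copies T2)%type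
    (FAnd (ren id (kpar T1) (phi_dom T1)) (btop T1 (@asg0 _) (phi_dom T2)))
    (fun c s => FAnd (ren id (kpar T1) (phi_node T1 c.1 tt)) (btop T1 (asg1 c.1) (phi_node T2 c.2 s)))
    (fun c d b => btop T1 (asg2 c.1 d.1) (phi_edge T2 c.2 d.2 b)).

Lemma mso_compP (g : graph Sg A) (h : graph unit D) :
  mso_rel mso_comp g h <-> exists h1, mso_rel T1 g h1 /\ mso_rel T2 h1 h.
Proof.
split=> [[nu [/= [/sat_ren dom1 dom2] /is_outputP[F [F1 F2 F3]]]]|].
  pose par p := nu (kpar T1 p).
  pose h1 := outgraph T1 par; pose G (v : gV h1) : gV g * copies T1 := val v.
  have O : outby par G by exact: outgraphP.
  pose nuh X (v : gV h1) := nu (kset T1 X (G v).2) (G v).1.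
  exists h1; split; first by exists par; split=> //; apply/is_outputP; exists G.
  exists nuh; split; first by move: dom2; apply sat_btop0 with (1 := O).
  (* A node of the composite output satisfies the node formula of [T1], hence lies over a node of
     [h1]. *)
  have /choice[f Hf] : forall v, exists w : gV h1, G w = ((F v).1, (F v).2.1).
    move=> v.
    have /= [|/sat_ren Hn _] := (F2 (F v).1 (F v).2).1; first by exists v; case: (F v).
    by have [_ H _] := O; apply/H.
  apply/is_outputP; exists (fun v => (f v, (F v).2.2)); split.
  - move=> u v [/(congr1 G)]; rewrite !Hf => -[E1 E2] E3; apply: F1.
    by move: E1 E2 E3; case: (F u) => [? []]; case: (F v) => [? []] /= ? ? ? ? -> -> ->.
  - move=> u c; have := F2 (G u).1 ((G u).2, c); rewrite /= sat_ren.
    rewrite (sat_btop1 (F := G) (par := par) (nuh2 := nuh)) // => E.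
    split=> [[v [Ev Ec]]|H].
      by apply E; exists v; rewrite -Ev Hf -Ec; case: (F v) => [? []].
    have [|v Ev] := E.2.
      by split=> //; case: O => [_ H' _]; apply/H'; exists u; case: (G u).
    have [iG _ _] := O; exists v; rewrite Ev /=; congr (_, _).
    by apply: iG; rewrite Hf Ev; case: (G u).
  - move=> v v' b; rewrite F3 /=.
    have E w : (F w).1 = (G (f w)).1 /\ (F w).2.1 = (G (f w)).2 by rewrite Hf.
    have [-> ->] := E v; have [-> ->] := E v'.
    exact: (sat_btop2 (F := G) (par := par) (nuh2 := nuh)).
move=> [h1 [[par [dom1 /is_outputP[F1 O1]]] [nuh [dom2 /is_outputP[F2 O2]]]]].
(* Decoding the index separates the parameters of [T1] from the traces of those of [T2]. *)
pose nu k u := match unpickle k : option (nat + nat * copies T1) with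
  | Some (inl p) => par p u
  | Some (inr (X, c)) => `[< exists2 v, F1 v = (u, c) & nuh X v >]
  | None => false end.
have Hp p : nu (kpar T1 p) =1 par p by move=> u; rewrite /nu /kpar pickleK.
have H2 X v : nuh X v = nu (kset T1 X (F1 v).2) (F1 v).1.
  rewrite /nu /kset pickleK; apply/idP/asboolP => [H|[v' E]]; first by exists v => //; case: (F1 v).
  by have [i1 _ _] := O1; rewrite (i1 v v') // E; case: (F1 v).
have S f nu1 : sat nu1 nu (ren id (kpar T1) f) <-> sat nu1 par f.
  by rewrite sat_ren; apply: sat_eqfun.
exists nu; split; first by split; [apply/S|apply/(sat_btop0 O1 Hp H2)].
have [i1 N1 _] := O1; have [i2 N2 E2] := O2.
apply/is_outputP; exists (fun v => ((F1 (F2 v).1).1, ((F1 (F2 v).1).2, (F2 v).2))); split.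
- move=> u v [a b c]; apply: i2; have: (F2 u).1 = (F2 v).1.
    by apply: i1; move: a b; case: (F1 _) => ? ?; case: (F1 _) => ? ? /= -> ->.
  by move: c; case: (F2 u) => ? ?; case: (F2 v) => ? ? /= -> ->.
- move=> u [c1 c2] /=; split=> [[v [<- <- <-]]|[/S/N1[v Ev]]].
    split; first by apply/S/N1; exists (F2 v).1; case: (F1 _).
    by apply/(sat_btop1 O1 Hp H2)/N2; exists v; case: (F2 v).
  rewrite -[u]/(u, c1).1 -[in asg1 c1]/(u, c1).2 -Ev => /(sat_btop1 O1 Hp H2)/N2[v' Ev'].
  by exists v'; rewrite Ev' Ev.
- by move=> v v' b; rewrite E2 /= (sat_btop2 O1 Hp H2).
Qed.

End Comp.

(** * String graphs *)

Section StringGraph.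
Variable A : finType.

Definition FEdges x y := FOrs (fun a : A => FEdge unit a x y).

(** Axioms of a labelled path: some node without incoming edge generates all nodes, and every node
    has at most one outgoing edge and at most one predecessor. Reachability is membership in all
    closed sets, hence the set quantifier. *)
Definition FString : mso unit A :=
  FAnd (FEx1 0 (FAnd (FNot (FEx1 1 (FEdges 1 0)))
     (FAll2 0 (FImp (FIn _ _ 0 0)
        (FImp (FAll1 1 (FAll1 2 (FImp (FIn _ _ 1 0) (FImp (FEdges 1 2) (FIn _ _ 2 0)))))
              (FAll1 1 (FIn _ _ 1 0)))))))
 (FAnd (FAll1 0 (FAll1 1 (FAll1 2 (FAnds (fun a : A => FAnds (fun b : A =>
        FImp (FEdge _ a 0 1) (FImp (FEdge _ b 0 2) (FAnd (FEq _ _ 1 2) (FBool (a == b))))))))))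
       (FAll1 0 (FAll1 1 (FAll1 2 (FImp (FEdges 1 0) (FImp (FEdges 2 0) (FEq _ _ 1 2))))))).

Definition string_like (g : graph unit A) :=
  [/\ exists2 x, forall y a, ~~ gE g y a x
        & forall U : gV g -> bool, U x -> (forall y z a, U y -> gE g y a z -> U z) -> forall y, U y,
      forall x y z a b, gE g x a y -> gE g x b z -> y = z /\ a = b
    & forall x y z a b, gE g y a x -> gE g z b x -> y = z].

Lemma sat_FString (g : graph unit A) nu1 nu2 :
  sat (g := g) nu1 nu2 FString <-> string_like g.
Proof.
split=> [/sat_And[/sat_Ex1[x /sat_And[/sat_Not R G]] /sat_And[O I]]|[[x R G] O I]].
- split.
  + exists x => [y a|U Ux Uc y].
      by apply/negP => H; apply: R; apply/sat_Ex1; exists y; apply/sat_Ors; exists a.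
    move/sat_All2/(_ U)/sat_Imp: G => /(_ Ux)/sat_Imp; set P := FAll1 1 (FAll1 2 _) => G.
    suff /G/sat_All1/(_ y) : sat (upd nu1 0 (Some x)) (upd nu2 0 U) P by [].
    apply/sat_All1 => u; apply/sat_All1 => v; apply/sat_Imp => Uu.
    by apply/sat_Imp => /sat_Ors[a /=]; apply: Uc.
  + move=> u v w a b Ea Eb; move/sat_All1/(_ u)/sat_All1/(_ v)/sat_All1/(_ w): O.
    move=> /sat_Ands/(_ a)/sat_Ands/(_ b)/sat_Imp/(_ Ea)/sat_Imp/(_ Eb).
    by move/sat_And => -[/= -> /sat_Bool/eqP].
  + move=> u v w a b Ea Eb; move/sat_All1/(_ u)/sat_All1/(_ v)/sat_All1/(_ w): I.
    have /[swap]/sat_Imp/[apply]/sat_Imp : sat (upd (upd (upd nu1 0 (Some u)) 1 (Some v)) 2 (Some w)) nu2 (FEdges 1 0).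
      by apply/sat_Ors; exists a.
    by apply; apply/sat_Ors; exists b.
- apply/sat_And; split; [apply/sat_Ex1; exists x; apply/sat_And; split; [apply/sat_Not|]|apply/sat_And; split].
  + by case/sat_Ex1=> y /sat_Ors[a /=]; apply/negP/R.
  + apply/sat_All2 => U; apply/sat_Imp => Ux; apply/sat_Imp => H; apply/sat_All1 => y.
    apply: G => // u v a Uu E; move/sat_All1/(_ u)/sat_All1/(_ v)/sat_Imp/(_ Uu)/sat_Imp: H.
    by apply; apply/sat_Ors; exists a.
  + apply/sat_All1 => u; apply/sat_All1 => v; apply/sat_All1 => w.
    apply/sat_Ands => a; apply/sat_Ands => b; apply/sat_Imp => Ea; apply/sat_Imp => Eb.
    by have [-> ->] := O _ _ _ _ _ Ea Eb; split=> //; apply/sat_Bool.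
  + apply/sat_All1 => u; apply/sat_All1 => v; apply/sat_All1 => w.
    by apply/sat_Imp => /sat_Ors[a Ea]; apply/sat_Imp => /sat_Ors[b Eb]; apply: I Ea Eb.
Qed.

Lemma onth_size (w : seq A) i : i < size w -> exists a, onth w i = Some a.
Proof. by elim: w i => [|a w IH] [|i] //= Hi; [exists a|apply: IH]. Qed.

Lemma edE (w : seq A) (u v : gV (ed w)) a :
  gE (ed w) u a v = (val v == (val u).+1) && (onth w (val u) == Some a).
Proof. by []. Qed.

Lemma ed_string (w : seq A) : string_like (ed w).
Proof.
split.
- exists ord0 => [y a //|U U0 Uc [y Hy]].
  elim: y Hy => [|y IH] Hy; first by congr (U _): U0; apply: val_inj.
  have [a Ha] := onth_size (w := w) (i := y) Hy.
  by apply: (Uc (Ordinal (ltnW Hy)) _ a (IH _)); rewrite edE /= Ha !eqxx.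
- move=> x y z a b; rewrite !edE => /andP[/eqP E1 /eqP E2] /andP[/eqP E3 /eqP E4].
  by split; [apply: val_inj; rewrite E1 E3|move: E4; rewrite E2 => -[]].
- move=> x y z a b; rewrite !edE => /andP[/eqP E1 _] /andP[/eqP E2 _].
  by apply: val_inj; move: E2; rewrite E1 => -[].
Qed.

(** The nodes are the orbit of the root under the successor function [f], which fixes a node without
    outgoing edge. Iterates below the order of the orbit are distinct, so consecutive ones are
    joined by an actual edge, whose label is the next letter. *)
Lemma string_like_ed (g : graph unit A) : string_like g -> exists w, giso g (ed w).
Proof.
case=> -[x R G] O I.
pose f u := odflt u [pick v | [exists a, gE g u a v]].
have fE u v a : gE g u a v -> f u = v.
  move=> E; rewrite /f; case: pickP => [v' /existsP[b E']|/(_ v)/existsP[]]; last by exists a.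
  by have [] := O _ _ _ _ _ E E'.
have C y : fconnect f x y.
  apply: G => [|y' z a /connect_trans + /fE <-]; first exact: connect0.
  by apply; apply: fconnect1.
have inj i j : i < order f x -> j < order f x -> iter i f x = iter j f x -> i = j.
  by move=> Hi Hj E; rewrite -(findex_iter Hi) E findex_iter.
have /(_ _ (leqnn _))[w [sw wE]] : forall m, m <= (order f x).-1 ->
    exists w : seq A, size w = m /\ forall i, i < size w ->
    exists2 a, onth w i = Some a & gE g (iter i f x) a (iter i.+1 f x).
  elim=> [|m IH] Hm; first by exists [::].
  have [w [sw wE]] := IH (ltnW Hm).
  have [a Ea] : exists a, gE g (iter m f x) a (iter m.+1 f x).
    have Hm' : m.+1 < order f x by rewrite -[order f x]prednK ?order_gt0.
    have := inj _ _ (ltnW Hm') Hm'; rewrite /=; move: (iter m f x) => u; rewrite /f.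
    case: pickP => [v /existsP[a Ea] _|_ /= H]; first by exists a.
    by case: (n_Sn _ (H erefl)).
  exists (rcons w a); rewrite size_rcons sw; split=> // i; rewrite ltnS leq_eqVlt.
  case/predU1P => [->|Hi]; first by exists a => //; rewrite onthE map_rcons nth_rcons size_map sw ltnn eqxx.
  by have [b Eb] := wE i ltac:(by rewrite sw); exists b; rewrite // onthE map_rcons nth_rcons size_map sw Hi -onthE.
have sw1 : (size w).+1 = order f x by rewrite sw prednK ?order_gt0.
exists w; apply: giso_sym; exists (fun i : 'I_(size w).+1 => iter i f x); split; last split.
- apply: inj_card_bij => [i j /inj E|]; first by apply: val_inj; apply: E; rewrite -sw1.
  by rewrite card_ord sw1 /order; apply: subset_leq_card; apply/subsetP => y _; apply: C.
- by move=> v; case: (glab g _).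
- move=> i a j; rewrite edE; apply/idP/andP => [E|[/eqP -> /eqP Hi]].
    case: j E => [[|j] Hj] /= E; first by have := R (iter i f x) a; rewrite E.
    have [|b Hb Eb] := wE j; first by rewrite -ltnS.
    have /inj ij : iter i f x = iter j f x by apply: I E Eb.
    have {}ij : i = j :> nat by apply: ij; rewrite -sw1 // ltnW.
    by rewrite ij eqxx Hb; rewrite ij in E; have [_ ->] := O _ _ _ _ _ E Eb.
  have Hs : i < size w.
    by rewrite ltnNge; apply/negP => H; move: Hi; rewrite onthE nth_default // size_map.
  by have [b] := wE _ Hs; rewrite Hi => -[->].
Qed.

Lemma sat_FString_ed (g : graph unit A) nu1 nu2 :
  sat (g := g) nu1 nu2 FString <-> exists w, giso g (ed w).
Proof.
rewrite sat_FString; split=> [/string_like_ed//|[w /giso_sym[e [eb [el eE]]]]].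
have := (sat_FString (g := ed w) (@asg0 _) (fun _ _ => false)).2 (ed_string w).
rewrite -(sat_FString (@asg0 _) (fun _ _ => false)).
by apply (sat_iso (e := e)).
Qed.

(** An isomorphism of paths preserves positions, by induction along the edges; the letters then
    agree. *)
Lemma ed_inj (w z : seq A) : giso (ed w) (ed z) -> w = z.
Proof.
case=> e [eb [_ eE]].
have Es : size w = size z by have := bij_eq_card eb; rewrite !card_ord => -[].
have ei : forall i : 'I_(size w).+1, val (e i) = val i.
  case=> i Hi /=; elim: i Hi => [|i IH] Hi.
    (* If position 0 went to [k.+1], the edge of [z] entering [k.+1] would come from an edge of [w]
       entering 0. *)
    case E: (val (e _)) => [//|k].
    have Hk : k < (size z).+1 by rewrite ltnW // -E; case: (e _).
    have [e' _ e'K] := eb.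
    have [a Ha] : exists a, onth z k = Some a.
      by apply: onth_size; rewrite -ltnS -E; case: (e _).
    by have := eE (e' (Ordinal Hk)) a (Ordinal Hi); rewrite e'K !edE /= E Ha !eqxx /=.
  have [a Ha] := onth_size (w := w) (i := i) Hi.
  have := eE (Ordinal (ltnW Hi)) a (Ordinal Hi); rewrite !edE /= Ha !eqxx /= IH.
  by case/andP=> /eqP.
have H i (Hi : i < size w) : onth w i = onth z i.
  have Hi' : i < (size w).+1 by rewrite ltnW.
  have [a Ha] := onth_size Hi.
  have := eE (Ordinal Hi') a (Ordinal (Hi : i.+1 < (size w).+1)); rewrite !edE /= Ha !eqxx /= !ei /=.
  by case/andP=> _ /eqP ->.
apply: (inj_map (@Some_inj _)); apply: (eq_from_nth (x0 := None)); rewrite !size_map // => i Hi.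
by rewrite -!onthE H.
Qed.

End StringGraph.

Section NM.
Variables (A B : finType).

(* On string graphs it is enough to compare with the outputs that are string
   graphs: the remaining ones are excluded by the domain formula. *)
Definition string_mso (m : strans A B) :=
  exists T : mso_trans unit A unit B, forall w z, m w z <-> mso_rel T (ed w) (ed z).

(** The domain formula is strengthened by [FString] for the input and by the backward translation of
    [FString] for the output; the renaming [kpar] makes room for the set variables of this
    translation. *)
Lemma string_mso_NMSO (m : strans A B) : string_mso m -> NMSO_ed m.
Proof.
case=> T H.
pose T1 := @MsoTrans unit A unit B (copies T)
  (FAnd (ren id (kpar T) (phi_dom T)) (FAnd (FString A) (btop T (@asg0 _) (FString B))))
  (fun c s => ren id (kpar T) (phi_node T c s))
  (fun c d b => ren id (kpar T) (phi_edge T c d b)).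
have P (g : graph unit A) (h : graph unit B) : mso_rel T1 g h <->
  [/\ mso_rel T g h, exists w, giso g (ed w) & exists z, giso h (ed z)].
- have R (nu : nat -> gV g -> bool) nu1 f : sat nu1 nu (ren id (kpar T) f) <->
    sat nu1 (fun p => nu (kpar T p)) f by rewrite sat_ren.
  split=> [[nu [/sat_And[/R dom /sat_And[sg sh]] /is_outputP[F O]]]|].
  + have {}O : outby (T := T) (g := g) (fun p => nu (kpar T p)) (h := h) F.
      by case: O => O1 O2 O3; split=> // [u c|v v' b]; [rewrite O2; apply: R|rewrite O3; apply: R].
    split; first by exists (fun p => nu (kpar T p)); split=> //; apply/is_outputP; exists F.
      exact/sat_FString_ed/sg.
    apply/(sat_FString_ed (@asg0 _) (fun X v => nu (kset T X (F v).2) (F v).1)).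
    exact: (sat_btop0 O (fun _ _ => erefl) (fun _ _ => erefl) _).1 sh.
  + move=> [[par [dom /is_outputP[F O]]] /sat_FString_ed sg /sat_FString_ed sh].
    pose nu k := if unpickle k : option (nat + nat * copies T) is Some (inl p) then par p else fun _ => false.
    have Hp p : nu (kpar T p) =1 par p by move=> u; rewrite /nu /kpar pickleK.
    have {}R nu1 f : sat nu1 nu (ren id (kpar T) f) <-> sat nu1 par f.
      by rewrite R; apply: sat_eqfun.
    exists nu; split.
      apply/sat_And; split; first by apply/R.
      by apply/sat_And; split; [apply: sg|apply/(sat_btop0 O Hp (fun _ _ => erefl))/sh].
    apply/is_outputP; exists F; case: O => O1 O2 O3; split=> // [u c|v v' b].
      by rewrite O2 R.
    by rewrite O3 R.
exists T1; split=> [w z /H mw|g h /P[m1 [w gw] [z hz]]].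
  by apply/P; split=> //; [exists w|exists z]; apply: giso_refl.
by exists w, z; split=> //; apply/H; apply: mso_rel_iso m1.
Qed.

End NM.

(** The first factor is put in the form of [NMSO_ed], which forces the intermediate graph of the
    composition to be a string graph. *)
Lemma string_mso_comp (A B D : finType) (m1 : strans A B) (m2 : strans B D) :
  string_mso m1 -> string_mso m2 -> string_mso (rcomp m1 m2).
Proof.
move=> /string_mso_NMSO[T1 [H1 H1']] [T2 H2].
exists (mso_comp T1 T2) => w z; rewrite mso_compP; split.
  by case=> b [/H1 mb /H2 mz]; exists (ed b).
case=> h [/[dup] Th /H1'[w' [b [mb /ed_inj -> hb]]] T2h].
by exists b; split=> //; apply/H2; apply: mso_rel_iso T2h => //; apply: giso_refl.
Qed.

(** * Transductions defined by functions on strings *)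

(** The parameters prescribe the range of the embedding and the edges on it; only the names of the
    nodes are free. *)
Lemma outby_unique Sg Gm Gm' (T : mso_trans Sg Gm unit Gm') (g : graph Sg Gm) nu2
    (h h' : graph unit Gm') F F' :
  outby (T := T) (g := g) nu2 (h := h) F -> outby (T := T) (g := g) nu2 (h := h') F' ->
  giso h h'.
Proof.
move=> [F1 F2 F3] [G1 G2 G3].
have /choice[e He] v : exists v', F' v' = F v.
  by case E: (F v) => [u c]; apply/G2/F2; exists v.
have /choice[e' He'] v : exists v', F v' = F' v.
  by case E: (F' v) => [u c]; apply/F2/G2; exists v.
exists e; split; last split.
- by exists e' => v; [apply: F1; rewrite He' He|apply: G1; rewrite He He'].
- by move=> v; case: (glab _ _); case: (glab _ _).
- by move=> u b v; apply/idP/idP => [/G3|/F3]; rewrite ?He => H; [apply/F3|apply/G3; rewrite !He].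
Qed.

Lemma outby_giso Sg Gm Gm' (T : mso_trans Sg Gm unit Gm') (g : graph Sg Gm) nu2
    (h h' : graph unit Gm') F :
  giso h h' -> outby (T := T) (g := g) nu2 (h := h) F ->
  exists F', outby (T := T) (g := g) nu2 (h := h') F'.
Proof.
move=> /giso_sym[e [eb [_ eE]]] [F1 F2 F3]; have [e' eK e'K] := eb; exists (F \o e); split.
- exact: inj_comp F1 (bij_inj eb).
- move=> u c; rewrite -F2; split=> -[v Ev]; first by exists (e v).
  by exists (e' v); rewrite /= e'K.
- by move=> v v' b; rewrite -eE F3.
Qed.

(** Exhibiting one output for each valuation suffices, since outputs are unique up to isomorphism
    and [ed] is injective. *)
Lemma string_mso_fun (A B : finType) (T : mso_trans unit A unit B) (fn : seq A -> seq B) :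
  (forall w nu2, sat (g := ed w) (@asg0 _) nu2 (phi_dom T)) ->
  (forall w nu2, exists F, outby (T := T) (g := ed w) nu2 (h := ed (fn w)) F) ->
  string_mso (fun w z => z = fn w).
Proof.
move=> Hd Ho; exists T => w z; split=> [->|[nu [_ /is_outputP[F O]]]].
  by exists (fun _ _ => false); split=> //; apply/is_outputP.
have [F' O'] := Ho w nu; exact/ed_inj/(outby_unique O O').
Qed.

Lemma string_mso_ext (A B : finType) (m m' : strans A B) :
  (forall w z, m w z <-> m' w z) -> string_mso m -> string_mso m'.
Proof. by move=> E [T H]; exists T => w z; rewrite -E. Qed.

Lemma FEdgesP (A : finType) (w : seq A) nu1 (nu2 : nat -> gV (ed w) -> bool) x y u v :
  nu1 x = Some u -> nu1 y = Some v -> sat nu1 nu2 (FEdges A x y) <-> val v = (val u).+1.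
Proof.
move=> Ex Ey; rewrite sat_Ors /= Ex Ey; split=> [[a /andP[/eqP//]]|E].
have [a Ha] : exists a, onth w (val u) = Some a.
  by apply: onth_size; have := ltn_ord v; rewrite [nat_of_ord v]E ltnS.
by exists a; rewrite Ha E !eqxx.
Qed.

Arguments FEdgesP {A w nu1 nu2 x y} u v.

(** * Appending an end marker *)

Section EndMarker.
Variable A : finType.

(** The tape on [w] has one position more than [ed w] has nodes. After the extra letter, nodes are
    tape positions, and [None] stands for the right end marker. *)
Definition endmark (w : seq A) : seq (option A) := rcons (map Some w) None.

Lemma onth_endmark w i : onth (endmark w) i =
  if i < size w then Some (onth w i) else if i == size w then Some None else None.
Proof.
rewrite onthE /endmark map_rcons nth_rcons !size_map; case: ifP => // Hi.
by rewrite -map_comp onthE; case: w i Hi => [|a w] i Hi //; rewrite !(nth_map a).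
Qed.

(** Copy [true] exists at the last node only, where the new edge leads to it from copy [false]. *)
Definition T_endmark : mso_trans unit A unit (option A) :=
  @MsoTrans unit A unit (option A) bool (FBool true)
    (fun c _ => if c then FNot (FEx1 1 (FEdges A 0 1)) else FBool true)
    (fun c d o => match c, d, o with
       | false, false, Some a => FEdge unit a 0 1
       | false, true, None => FEq unit A 0 1
       | _, _, _ => FFalse end).

Lemma string_mso_endmark : string_mso (fun w v => v = endmark w).
Proof.
apply: (@string_mso_fun _ _ T_endmark) => w nu; first exact/sat_Bool.
have sz : size (endmark w) = (size w).+1 by rewrite size_rcons size_map.
have L0 (u : 'I_(size w).+1) : val u < size w \/ u = ord_max.
  case: (ltngtP u (size w)) => [|H|H]; [by left| |by right; apply: val_inj].
  by have := ltn_ord u; rewrite ltnS leqNgt H.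
pose F (i : gV (ed (endmark w))) : gV (ed w) * bool :=
  if val i <= size w then (inord (val i), false) else (ord_max, true).
exists F; split.
- move=> [i Hi] [j Hj]; rewrite /F /= => E; apply: val_inj => /=; move: E.
  have [Hi'|Hi'] := leqP i (size w); have [Hj'|Hj'] := leqP j (size w) => //.
    by case=> /(congr1 val); rewrite /= !inordK.
  by move: Hi Hj; rewrite sz !ltnS => Hi Hj _; apply/eqP; rewrite eqn_leq (leq_trans Hi Hj') (leq_trans Hj Hi').
- move=> u []; last first.
    split=> _; first by apply/(sat_Bool _ _ true).
    exists (inord (val u)).
    have Hu : val u <= size w by have := ltn_ord u.
    have Hu' : val u < (size (endmark w)).+1 by rewrite sz ltnS leqW.
    by rewrite /F /= inordK // Hu inord_val.
  have N : sat (asg1 u) nu (FNot (FEx1 1 (FEdges A 0 1))) <-> u = ord_max.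
    rewrite sat_Not sat_Ex1; split=> [H|-> [v]].
      case: (L0 u) => // Hu; case: H.
      pose v : gV (ed w) := Ordinal (Hu : u.+1 < (size w).+1).
      by exists v; apply/(FEdgesP u v).
    by rewrite (FEdgesP ord_max v) // => E; have := ltn_ord v; rewrite [nat_of_ord v]E ltnn.
  apply: (iff_trans _ (iff_sym N)); split=> [[i]|->].
    by rewrite /F; case: ifP => // _ [].
  have Hm : (size w).+1 < (size (endmark w)).+1 by rewrite sz.
  by exists (Ordinal Hm); rewrite /F /= ltnn.
- move=> i j o; rewrite edE /F.
  have Hi : val i <= (size w).+1 by have := ltn_ord i; rewrite [X in _ < X.+1]sz.
  have Hj : val j <= (size w).+1 by have := ltn_ord j; rewrite [X in _ < X.+1]sz.
  have [Hi'|Hi'] := leqP i (size w); have [Hj'|Hj'] := leqP j (size w) .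
  + case: o => [a|]; rewrite ?sat_False /=.
      rewrite !inordK // onth_endmark; case: (ltngtP i (size w)) Hi' => // E _.
      by split=> /andP[] // /eqP Ej; move: Hj'; rewrite Ej E ltnn.
    split=> //; case/andP=> /eqP Ej; rewrite onth_endmark -[X in X <= _]Ej Hj'.
    by have [a ->] : exists a, onth w i = Some a by apply: onth_size; rewrite -[X in X <= _]Ej.
  + have ij : val j = (val i).+1 <-> val i = size w.
      split=> [E|->]; first by apply/eqP; rewrite eqn_leq Hi' -ltnS -[X in _ < X]E.
      by apply/eqP; rewrite eqn_leq Hj Hj'.
    case: o => [a|]; rewrite ?sat_False /=.
      by split=> // /andP[/eqP/ij Ei]; rewrite onth_endmark [nat_of_ord i]Ei ltnn eqxx.
    split=> [/andP[/eqP/ij Ei] _|/(congr1 val) /=].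
      by apply: val_inj; rewrite /= inordK.
    rewrite inordK // => Ei; apply/andP; split; first exact/eqP/ij.
    by rewrite onth_endmark Ei ltnn eqxx.
  + split=> [/andP[/eqP Ej _]|]; last by case: o => [?|] /sat_False.
    have : i < size w by rewrite -[X in X <= _]Ej.
    by rewrite ltnNge (ltnW Hi').
  + split=> [/andP[/eqP Ej _]|]; last by case: o => [?|] /sat_False.
    have : i.+1 <= (size w).+1 by rewrite -[X in X <= _]Ej.
    by rewrite ltnS leqNgt Hi'.
Qed.

End EndMarker.

(** * String homomorphisms *)

Section Order.
Variable A : finType.

(** The reachability order of the path, through sets closed under successor. The bound node
    variables 3 and 4 leave 0, 1 and 2 for [x] and [y]. *)
Definition FLe x y : mso unit A :=
  FAll2 0 (FImp (FIn _ _ x 0)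
    (FImp (FAll1 3 (FAll1 4 (FImp (FIn _ _ 3 0) (FImp (FEdges A 3 4) (FIn _ _ 4 0)))))
       (FIn _ _ y 0))).

Lemma sat_FLe (w : seq A) nu1 (nu2 : nat -> gV (ed w) -> bool) x y u v :
  x < 3 -> y < 3 -> nu1 x = Some u -> nu1 y = Some v ->
  sat nu1 nu2 (FLe x y) <-> val u <= val v.
Proof.
move=> x3 y3 Ex Ey; rewrite sat_All2; split=> [H|uv U].
  pose U (v : gV (ed w)) := val u <= val v.
  have /sat_Imp := H U; set P := FAll1 3 _ => {}H.
  have /H/sat_Imp {}H : sat nu1 (upd nu2 0 U) (FIn _ _ x 0) by rewrite /= Ex; apply: leqnn.
  suff /H : sat nu1 (upd nu2 0 U) P by rewrite /= Ey.
  apply/sat_All1 => a; apply/sat_All1 => b; apply/sat_Imp => ua; apply/sat_Imp.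
  by rewrite (FEdgesP a b) // => E; apply: leq_trans (ua : is_true (val u <= val a)) _; rewrite E.
apply/sat_Imp => Uu; apply/sat_Imp => /sat_All1 H; rewrite /= Ey.
have {}Uu : U u by move: Uu; rewrite /= Ex.
have {}H a b : U a -> val b = (val a).+1 -> U b.
  move=> Ua Eb; move: (H a) => /sat_All1/(_ b)/sat_Imp/(_ Ua)/sat_Imp; apply.
  exact/(FEdgesP a b).
case: v uv {Ey} => v Hv /=; elim: v Hv => [|v IH] Hv.
  by rewrite leqn0 => /eqP E; congr (U _): Uu; apply: val_inj.
rewrite leq_eqVlt ltnS => /predU1P[E|uv]; first by congr (U _): Uu; apply: val_inj.
by apply: (H (Ordinal (ltnW Hv))) => //; apply: IH.
Qed.

End Order.

Section Hom.
Variables (A B : finType) (h : A -> seq B).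

Definition hom (t : seq A) : seq B := flatten (map h t).

(* Node [(s, l)] precedes the letter [l] of the image of the letter [s] of [t];
   the last node of the output is [(size t, 0)]. *)
Fixpoint hnodes (t : seq A) : seq (nat * nat) :=
  if t is a :: t' then
    [seq (0, l) | l <- iota 0 (size (h a))] ++ [seq (p.1.+1, p.2) | p <- hnodes t']
  else [:: (0, 0)].

(** Number of output nodes over position [s]: one for each letter of the image, and the single last
    node over [size t], whence the boolean read as a number. *)
Fixpoint hlen (t : seq A) (s : nat) : nat :=
  match t, s with
  | [::], s => s == 0
  | a :: _, 0 => size (h a)
  | _ :: t', s'.+1 => hlen t' s'
  end.

Lemma size_hnodes t : size (hnodes t) = (size (hom t)).+1.
Proof. by elim: t => //= a t IH; rewrite !size_cat !size_map size_iota IH addnS. Qed.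

Lemma mem_hnodes t s l : ((s, l) \in hnodes t) = (l < hlen t s).
Proof.
elim: t s l => [|a t IH] s l /=.
  by rewrite inE xpair_eqE; case: s l => [|s] [|l].
rewrite mem_cat; case: s => [|s].
  rewrite mem_map => [|? ? []//]; rewrite mem_iota /= add0n orbC.
  by case: mapP => // -[p _ []].
rewrite -IH; case: mapP => [[? _ []//]|_] /=.
by rewrite (mem_map (f := fun p => (p.1.+1, p.2)) _ _ (s, l)) // => -[? ?] [? ?] /= [-> ->].
Qed.

Lemma uniq_hnodes t : uniq (hnodes t).
Proof.
elim: t => //= a t IH; rewrite cat_uniq !map_inj_uniq ?iota_uniq ?IH /= ?andbT.
- by apply/hasPn => _ /mapP[p _ ->]; apply/mapP => -[].
- by move=> [? ?] [? ?] /= [-> ->].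
- by move=> ? ? [].
Qed.

(** The successor relation in a form that mso can express: either the next letter of the same image,
    or a jump from the end of an image over positions without output nodes. *)
Definition hnext (t : seq A) (p q : nat * nat) (b : B) : Prop :=
  exists a, [/\ onth t p.1 = Some a, onth (h a) p.2 = Some b &
    (q.1 = p.1 /\ q.2 = p.2.+1) \/
    [/\ p.2.+1 = size (h a), q.2 = 0, p.1 < q.1 &
        forall k, p.1 < k -> k < q.1 -> hlen t k = 0]].

Lemma hnodes_head t : (nth (0, 0) (hnodes t) 0).2 = 0.
Proof.
elim: t => //= a t IH; case: (h a) => //=.
by rewrite (nth_map (0, 0)) ?size_hnodes.
Qed.

(** Handles the jump: on leaving the image of the head letter, [hnext] has to land on the first node
    of the tail. *)
Lemma hnodes_first t j s :
  j < size (hnodes t) -> nth (0, 0) (hnodes t) j = (s, 0) ->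
  (forall k, k < s -> hlen t k = 0) <-> j = 0.
Proof.
elim: t j s => [|a t IH] j s /=.
  by rewrite ltnS leqn0 => /eqP -> [<-].
rewrite size_cat !size_map size_iota nth_cat size_map size_iota => Hj.
case: ltnP => Hja.
  rewrite (nth_map 0) ?size_iota // nth_iota // add0n => -[<- ->]; by split.
have Hj' : j - size (h a) < size (hnodes t) by rewrite ltn_subLR.
rewrite (nth_map (0, 0)) //; case: s => // s [E1 E2].
have {}IH : (forall k, k < s -> hlen t k = 0) <-> j - size (h a) = 0.
  by apply: IH => //; move: E1 E2; case: (nth _ _ _) => ? ? /= -> ->.
split=> [H|E].
  have Ea : size (h a) = 0 := H 0 isT.
  by have := IH.1 (fun k ks => H k.+1 ks); rewrite Ea subn0.
have Ea : size (h a) = 0 by move: Hja; rewrite E leqn0 => /eqP.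
by case=> [|k] //= ks; apply: (IH.2 _ k) => //; rewrite E Ea.
Qed.

Lemma hnextP t i j b :
  i < size (hnodes t) -> j < size (hnodes t) ->
  hnext t (nth (0, 0) (hnodes t) i) (nth (0, 0) (hnodes t) j) b <->
  j = i.+1 /\ onth (hom t) i = Some b.
Proof.
elim: t i j => [|a t IH] i j /=.
  rewrite !ltnS !leqn0 => /eqP -> /eqP ->; split=> [[a []//]|[]//].
rewrite size_cat !size_map size_iota !nth_cat size_map size_iota => Hi Hj.
rewrite -[hom (a :: t)]/(h a ++ hom t) onth_cat.
have [Hia|Hia] := ltnP i (size (h a)).
  rewrite (nth_map 0) ?size_iota // nth_iota // add0n.
  have [Hja|Hja] := ltnP j (size (h a)).
    rewrite (nth_map 0) ?size_iota // nth_iota // add0n.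
    split=> [[_ [[<-] /= -> [[_ ->]|[]]]]//|[-> Hb]].
    by exists a; split=> //; left.
  have Hj' : j - size (h a) < size (hnodes t) by rewrite ltn_subLR.
  rewrite (nth_map (0, 0)) //; case E: (nth _ _ _) => [s l]; split.
    case=> _ [[<-] /= -> [[]//|[Ei El _ Hk]]]; split=> //.
    rewrite El in E; have [/(_ _) H _] := hnodes_first Hj' E.
    have /H E0 : forall k, k < s -> hlen t k = 0 by move=> k ks; apply: (Hk k.+1).
    by apply/eqP; rewrite Ei eqn_leq Hja andbT -subn_eq0 E0.
  move=> [Ej Hb]; exists a; split=> //; right.
  have Ei : i.+1 = size (h a) by apply/eqP; rewrite eqn_leq Hia -Ej.
  have E0 : j - size (h a) = 0 by rewrite Ej Ei subnn.
  have El : l = 0.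
    by have := hnodes_head t; rewrite -[X in nth _ _ X]E0 E.
  split=> //= k; case: k => // k _ ks; rewrite /= in E.
  rewrite El in E; have [_ H] := hnodes_first Hj' E.
  by apply: H.
have Hi' : i - size (h a) < size (hnodes t) by rewrite ltn_subLR.
rewrite (nth_map (0, 0)) //; case E: (nth _ _ (i - _)) => [s l].
have [Hja|Hja] := ltnP j (size (h a)).
  rewrite (nth_map 0) ?size_iota // nth_iota // add0n.
  split=> [[_ [_ _ [[]|[]]]]//|[Ej]].
  by move: Hja; rewrite Ej ltnNge (leqW Hia).
have Hj' : j - size (h a) < size (hnodes t) by rewrite ltn_subLR.
rewrite (nth_map (0, 0)) //; case E': (nth _ _ (j - _)) => [s' l'].
have := IH _ _ Hi' Hj'; rewrite E E' => {}IH.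
have -> : j = i.+1 <-> j - size (h a) = (i - size (h a)).+1.
  rewrite -subSn //; split=> [->//|/eqP]; rewrite eqn_sub2rE ?leqW //.
  by move/eqP.
rewrite -IH; split=> -[c [H1 H2 H3]]; exists c; split=> //.
  case: H3 => /= [[[-> ->]]|[-> -> ss Hk]]; [by left|right; split=> // k sk ks].
  exact: (Hk k.+1).
case: H3 => /= [[-> ->]|[-> -> ss Hk]]; [by left|right; split=> // -[//|k] sk ks].
exact: Hk.
Qed.
Lemma hlenE t s : hlen t s = if onth t s is Some a then size (h a) else s == size t.
Proof. by elim: t s => [|a t IH] [|s] //=; rewrite IH. Qed.

Lemma hlen_max t s : hlen t s <= (\max_a size (h a)).+1.
Proof.
rewrite hlenE; case: (onth t s) => [a|]; last by case: (_ == _).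
by apply: leqW; rewrite (leq_bigmax a).
Qed.

Definition FLt x y := FAnd (FLe A x y) (FNot (FEq unit A x y)).
Definition FOut a x := FEx1 3 (FEdge unit a x 3 : mso unit A).

(** The successor in the number of copies provides copy 0 of the last node even when [h] erases
    every letter. *)
Definition T_hom : mso_trans unit A unit B :=
  @MsoTrans unit A unit B 'I_(\max_a size (h a)).+1 (FBool true)
    (fun c _ => FOr (FOrs (fun a : A => FAnd (FOut a 0) (FBool (c < size (h a)))))
                    (FAnd (FNot (FOrs (fun a : A => FOut a 0))) (FBool (val c == 0))))
    (fun c d b => FOrs (fun a : A => FAnd (FOut a 0) (FAnd (FBool (onth (h a) c == Some b))
       (FOr (FAnd (FEq unit A 0 1) (FBool (val d == c.+1)))
            (FAnd (FBool ((c.+1 == size (h a)) && (val d == 0)))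
               (FAnd (FLt 0 1) (FAll1 2 (FImp (FLt 0 2) (FImp (FLt 2 1)
                   (FOrs (fun a : A => FAnd (FOut a 2) (FBool (h a == [::]))))))))))))).

Section Sem.
Variables (t : seq A) (nu1 : nat -> option (gV (ed t))) (nu2 : nat -> gV (ed t) -> bool).

Lemma FOutP a x u : x < 3 -> nu1 x = Some u -> sat nu1 nu2 (FOut a x) <-> onth t (val u) = Some a.
Proof.
move=> x3 Ex; rewrite sat_Ex1 /= /upd (ltn_eqF x3) Ex; split=> [[v /andP[_ /eqP//]]|E].
have Hu : val u < size t.
  by rewrite ltnNge; apply/negP => H; rewrite onth_default in E.
by exists (Ordinal (Hu : (val u).+1 < (size t).+1)); rewrite eqxx E eqxx.
Qed.

Lemma FLtP x y u v : x < 3 -> y < 3 -> nu1 x = Some u -> nu1 y = Some v ->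
  sat nu1 nu2 (FLt x y) <-> val u < val v.
Proof.
move=> x3 y3 Ex Ey; rewrite sat_And (sat_FLe _ x3 y3 Ex Ey) /= Ex Ey ltn_neqAle; split.
  by case=> -> /eqP; rewrite andbT.
by case/andP=> /eqP E ->; split=> // uv; case: E; rewrite uv.
Qed.

End Sem.
Arguments FOutP {t nu1 nu2 a} x u _ _.
Arguments FLtP {t nu1 nu2} x y u v _ _ _ _.

Lemma onth_last (t : seq A) (u : 'I_(size t).+1) : onth t u = None <-> val u = size t.
Proof.
split=> [E|->]; last by rewrite onth_default.
apply/eqP; rewrite eqn_leq -[X in X && _]ltnS (ltn_ord u) /= leqNgt; apply/negP => H.
by have [a] := onth_size H; rewrite E.
Qed.

Lemma string_mso_hom : string_mso (fun t z => z = hom t).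
Proof.
apply: (@string_mso_fun _ _ T_hom) => t nu; first exact/sat_Bool.
pose N i := nth (0, 0) (hnodes t) i.
have NL i : i < (size (hom t)).+1 -> (N i).1 < (size t).+1 /\ (N i).2 < (\max_a size (h a)).+1.
  rewrite -size_hnodes => Hi; have := mem_nth (0, 0) Hi; rewrite -/(N i).
  case: (N i) => s l; rewrite mem_hnodes => Hl; split; last exact: leq_trans (hlen_max t s).
  move: Hl; rewrite hlenE /= ltnS; case E: (onth t s) => [a|].
    by move=> _; rewrite ltnW // ltnNge; apply/negP => H; rewrite onth_default in E.
  by case: eqP => [->|].
pose F (i : gV (ed (hom t))) : gV (ed t) * copies T_hom := (inord (N (val i)).1, inord (N (val i)).2).
have F1E i : val (F i).1 = (N (val i)).1 by rewrite /F /= inordK //; case: (NL _ (ltn_ord i)).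
have F2E i : val (F i).2 = (N (val i)).2 by rewrite /F /= inordK //; case: (NL _ (ltn_ord i)).
exists F; split.
- move=> i j E; apply: val_inj; apply/eqP.
  rewrite -(nth_uniq (0, 0) (s := hnodes t)) ?uniq_hnodes ?size_hnodes ?(ltn_ord i) ?(ltn_ord j) //.
  rewrite -/(N _) -/(N (val j)) -pair_eqE /pair_eq -!F1E -!F2E E !eqxx //.
- move=> u c; transitivity (val c < hlen t (val u)).
    split=> [[i Ei]|Hc].
      have := mem_nth (0, 0) (s := hnodes t) (n := val i); rewrite size_hnodes => /(_ (ltn_ord i)).
      by rewrite -/(N (val i)) [N _]surjective_pairing -F1E -F2E Ei mem_hnodes.
    move: Hc; rewrite -mem_hnodes => /(nthP (0, 0))[i Hi Ei]; rewrite size_hnodes in Hi.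
    exists (Ordinal Hi); rewrite /F /= /N Ei /=; by congr (_, _); rewrite inord_val.
  rewrite hlenE.
  split=> [H|/sat_Or[/sat_Ors[a /sat_And[/(FOutP 0 u isT erefl) -> /sat_Bool//]]|/sat_And[/sat_Not Hn /sat_Bool/eqP Hc]]].
    case E: (onth t (val u)) H => [a|] H; apply/sat_Or; [left|right].
      by apply/sat_Ors; exists a; apply/sat_And; split; [apply/(FOutP 0 u isT erefl)|apply/sat_Bool].
    apply/sat_And; split; first by apply/sat_Not; case/sat_Ors => a /(FOutP 0 u isT erefl); rewrite E.
    by apply/sat_Bool; move: H; case: (_ == _) => //; rewrite ltnS leqn0.
  case E: (onth t (val u)) => [a|].
    by case: Hn; apply/sat_Ors; exists a; apply/(FOutP 0 u isT erefl).
  by move/onth_last: E => ->; rewrite Hc eqxx.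
- move=> i j b; rewrite edE.
  transitivity (hnext t (N (val i)) (N (val j)) b).
    rewrite hnextP ?size_hnodes ?(ltn_ord i) ?(ltn_ord j) //.
    by split=> [/andP[/eqP -> /eqP ->]|[-> ->]] //; rewrite !eqxx.
  rewrite /hnext -!F1E -!F2E; move: (F i) (F j) => [u c] [v d] {F F1E F2E}.
  rewrite [(_, _).1]/= [(_, _).2]/=.
  have S a : sat (asg2 u v) nu (FOut a 0) <-> onth t (val u) = Some a by apply: FOutP.
  split=> [[a [Ea Eb H]]|/sat_Ors[a /sat_And[/S Ea /sat_And[/sat_Bool/eqP Eb H]]]].
    apply/sat_Ors; exists a; apply/sat_And; split; first exact/S.
    apply/sat_And; split; first by apply/sat_Bool/eqP.
    apply/sat_Or.
    case: H => [[E1 E2]|[E1 E2 uv Hk]]; [left|right].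
      by apply/sat_And; split; [apply: val_inj|apply/sat_Bool/eqP].
    apply/sat_And; split; first by apply/sat_Bool; rewrite E1 E2 !eqxx.
    apply/sat_And; split; first exact/(FLtP 0 1 u v isT isT erefl erefl).
    apply/sat_All1 => k; apply/sat_Imp => /(FLtP 0 2 u k isT isT erefl erefl) uk.
    apply/sat_Imp => /(FLtP 2 1 k v isT isT erefl erefl) kv; apply/sat_Ors.
    have := Hk (val k); rewrite uk kv hlenE => /(_ isT isT).
    case E: (onth t (val k)) => [a'|].
      move/size0nil => Ea'; exists a'; apply/sat_And; split; last by apply/sat_Bool/eqP.
      exact/(FOutP 2 k isT erefl).
    move/onth_last: E => E; move: kv; rewrite E => tv.
    by have := ltn_ord v; rewrite ltnS leqNgt tv.
  exists a; split=> //; case/sat_Or: H => [/sat_And[/= -> /sat_Bool/eqP ->]|]; first by left.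
  case/sat_And => /sat_Bool/andP[/eqP E1 /eqP E2] /sat_And[/(FLtP 0 1 u v isT isT erefl erefl) uv /sat_All1 Hk].
  right; split=> // k uk kv.
  have Hkt : k < (size t).+1 by apply: leq_trans kv _; apply: ltnW; apply: ltn_ord.
  move/(_ (Ordinal Hkt))/sat_Imp: Hk => Hk.
  have /Hk/sat_Imp {}Hk : sat (upd (asg2 u v) 2 (Some (Ordinal Hkt : gV (ed t)))) nu (FLt 0 2).
    exact/(FLtP 0 2 (u) (Ordinal Hkt) isT isT erefl erefl).
  have /Hk/sat_Ors[a' /sat_And[/(FOutP 2 (Ordinal Hkt) isT erefl) Ea' /sat_Bool/eqP E]] :
    sat (upd (asg2 u v) 2 (Some (Ordinal Hkt : gV (ed t)))) nu (FLt 2 1).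
    exact/(FLtP 2 1 (Ordinal Hkt) (v) isT isT erefl erefl).
  by rewrite hlenE Ea' // E.
Qed.

End Hom.

(** * From finite visit machines to transductions *)

Lemma inseqP (A : Type) (x : A) (s : seq A) :
  inseq x s <-> exists k, tnth (in_tuple s) k = x.
Proof.
elim: s => [|y s IH] /=; first by split=> // -[[]].
split=> [[->|/IH[k <-]]|[k]]; first by exists ord0.
  by exists (lift ord0 k); rewrite !(tnth_nth x).
case: (unliftP ord0 k) => [j ->|->] E; last by left; rewrite -E (tnth_nth x).
by right; apply/IH; exists j; rewrite -E !(tnth_nth x).
Qed.

Lemma tape_sym S (w : seq S) i : tape w i = match i with 0 => LEnd | i'.+1 =>
   if onth w i' is Some a then Sym a else REnd end.
Proof.
case: i => // i /=; elim: w i => [|a w IH] [|i] //=.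
Qed.

Section Trace.
Variables (S1 S2 : finType) (M : gsm S1 S2).

(** An instruction together with the outcome of its test, which selects the branch. *)
Definition trlabel : finType := ('I_(size (delta M)) * bool)%type.
Definition ins_of (k : trlabel) := tnth (in_tuple (delta M)) k.1.
Definition trtarget (k : trlabel) := if k.2 then ins_q1 (ins_of k) else ins_q0 (ins_of k).
Definition trout (k : trlabel) := if k.2 then ins_a1 (ins_of k) else ins_a0 (ins_of k).
Definition trmove (k : trlabel) := if k.2 then ins_e1 (ins_of k) else ins_e0 (ins_of k).

Definition lstep (w : seq S1) (c : conf M) (k : trlabel) (c' : conf M) : Prop :=
  [/\ ins_p (ins_of k) = c.1, c'.1 = trtarget k, tape w c.2 = ins_sym (ins_of k) <-> k.2,
      moves c.2 (trmove k) c'.2 & c'.2 <= (size w).+1].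

Lemma step_lstep w (c c' : conf M) a :
  step w c c' a <-> exists2 k, lstep w c k c' & a = trout k.
Proof.
split=> [[ins /inseqP[k <-] [Ep H Hs]]|[[k b] [Ep Et Es Em Hs] ->]].
  by case: H => -[Es [E1 -> Em]]; [exists (k, true)|exists (k, false)].
exists (ins_of (k, b)); first by apply/inseqP; exists k.
split=> //; case: b Ep Et Es Em => Ep Et [E1 E2] Em; [left|right]; split=> //; first exact: E2.
by move/E1.
Qed.

Lemma comp_trace w c cs z :
  Defs.comp (M := M) w c cs z <-> exists t : seq trlabel, [/\ size t = size cs, z = hom trout t
    & forall i k, onth t i = Some k -> lstep w (nth c (c :: cs) i) k (nth c (c :: cs) i.+1)].
Proof.
split=> [|[t]].
  elim=> {c cs z} [c|c c' a cs z /step_lstep[k Hk ->] _ [t [st -> Ht]]]; first by exists [::]; split=> // -[].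
  exists (k :: t); split=> //=; first by rewrite st.
  move=> [|i] k' /=; first by case=> <-.
  move=> Hi; have := Ht _ _ Hi => /=.
  have Hi' : i < size cs by rewrite -st ltnNge; apply/negP => H; rewrite onth_default in Hi.
  by rewrite !(set_nth_default c' c) //= ltnW.
elim: t c cs z => [|k t IH] c [|c' cs] z [] //; first by move=> _ -> _; constructor.
case=> st -> Ht; rewrite -[hom _ _]/(trout k ++ hom trout t); apply: compS.
  by apply/step_lstep; exists k => //; apply: (Ht 0).
apply: IH; split=> // i k' Hi; have := Ht i.+1 _ Hi.
have Hi' : i < size cs by rewrite -st ltnNge; apply/negP => H; rewrite onth_default in Hi.
by rewrite /= !(set_nth_default c' c) //= ltnW.
Qed.

Variable K : nat.
(* A copy is a state and a visit number; parameter [xvar c] guesses the positions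
   visited as [c] and [yvar c d k] those left by instruction [k] towards copy [d].
   Only locally wrong guesses have to be excluded: that the visits form a single
   computation follows from the output being a string graph. *)
Definition trcopy : finType := (gQ M * 'I_K.+1)%type.
Definition xvar (c : trcopy) : nat := pickle (inl c : trcopy + trcopy * trcopy * trlabel).
Definition yvar (c d : trcopy) (k : trlabel) : nat := pickle (inr (c, d, k) : trcopy + trcopy * trcopy * trlabel).
Local Notation F := (mso unit (option S1)).

Definition FMove (e : dir) x y : F :=
  match e with
  | MLeft => FEdges _ y x
  | MStay => FEq _ _ x y
  | MRight => FEdges _ x y
  end.

(** The symbol at a position is the label of the edge entering it in [ed (endmark w)]; only the left
    end has no such edge. *)
Definition FSym (s : tsym S1) x : F :=
  match s with
  | LEnd => FNot (FEx1 3 (FEdges _ 3 x))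
  | REnd => FEx1 3 (FEdge _ None 3 x)
  | Sym a => FEx1 3 (FEdge _ (Some a) 3 x)
  end.

Definition FStep (c d : trcopy) (k : trlabel) x y : F :=
  FAnd (FAnd (FIn _ _ x (yvar c d k)) (FBool ((ins_p (ins_of k) == c.1) && (d.1 == trtarget k))))
    (FAnd (let f := FSym (ins_sym (ins_of k)) x in if k.2 then f else FNot f) (FMove (trmove k) x y)).

(** The domain formula asks each guessed visit to be initial or to have a predecessor, and to be in
    the final state or to have a successor. *)
Definition T_trace : mso_trans unit (option S1) unit trlabel :=
  @MsoTrans unit (option S1) unit trlabel trcopy
   (FAnds (fun c : trcopy => FAll1 0 (FImp (FIn _ _ 0 (xvar c))
     (FAnd (FOr (FAnd (FBool (c.1 == q_in M)) (FSym LEnd 0))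
                (FOrs (fun dk : trcopy * trlabel => FEx1 1 (FAnd (FIn _ _ 1 (xvar dk.1)) (FStep dk.1 c dk.2 1 0)))))
           (FOr (FBool (c.1 == q_f M))
                (FOrs (fun dk : trcopy * trlabel => FEx1 1 (FAnd (FIn _ _ 1 (xvar dk.1)) (FStep c dk.1 dk.2 0 1)))))))))
   (fun c _ => FIn _ _ 0 (xvar c))
   (fun c d k => FStep c d k 0 1).

Section Sem.
Variables (w : seq S1).
Local Notation G := (ed (endmark w)).
Variables (nu1 : nat -> option (gV G)) (nu2 : nat -> gV G -> bool).

Lemma pos_bound (u : gV G) : val u <= (size w).+1.
Proof. by have := ltn_ord u; rewrite [X in _ < X.+1]size_rcons size_map. Qed.

Lemma FMoveP e x y u v : nu1 x = Some u -> nu1 y = Some v ->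
  sat nu1 nu2 (FMove e x y) <-> moves (val u) e (val v).
Proof.
move=> Ex Ey; case: e => /=; [exact: FEdgesP| |exact: FEdgesP].
by rewrite Ex Ey; split=> [->|E] //; apply: val_inj.
Qed.

Lemma FSymP s x u : x < 3 -> nu1 x = Some u ->
  sat nu1 nu2 (FSym s x) <-> tape w (val u) = s.
Proof.
move=> x3 Ex; rewrite tape_sym.
have P o : sat nu1 nu2 (FEx1 3 (FEdge _ o 3 x)) <-> exists2 i, val u = i.+1 & onth (endmark w) i = Some o.
  rewrite sat_Ex1 /= /upd (ltn_eqF x3) Ex; split=> [[v /andP[/eqP E1 /eqP E2]]|[i Ei Eo]].
    by exists (val v).
  have Hi : i < (size (endmark w)).+1 by rewrite ltnW // -Ei; exact: ltn_ord.
  by exists (Ordinal Hi); rewrite [nat_of_ord u]Ei /= Eo !eqxx.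
have Q i : val u = i.+1 -> onth (endmark w) i = Some (onth w i).
  move=> Ei; rewrite onth_endmark; have := pos_bound u; rewrite Ei ltnS.
  by case: ltngtP => // -> _; rewrite onth_default.
case: s => [||a]; rewrite [FSym _ _]/=.
- rewrite sat_Not sat_Ex1.
  case E: (val u) => [|i]; split=> //.
  + move=> _ [v]; rewrite (FEdgesP v u) //; first by rewrite E.
    by rewrite /upd (ltn_eqF x3).
  + case; have Hi : i < (size (endmark w)).+1 by rewrite ltnW // -E; exact: ltn_ord.
    exists (Ordinal Hi); rewrite (FEdgesP (Ordinal Hi) u) //.
    by rewrite /upd (ltn_eqF x3).
  + by case: (onth w i).
- rewrite P; case E: (val u) => [|i]; first by split=> // -[].
  split=> [[_ [<-]]|]; first by rewrite Q // => -[->].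
  by case Ew: (onth w i) => // _; exists i => //; rewrite Q // Ew.
- rewrite P; case E: (val u) => [|i]; first by split=> // -[].
  split=> [[_ [<-]]|]; first by rewrite Q // => -[->].
  by case Ew: (onth w i) => // -[<-]; exists i => //; rewrite Q // Ew.
Qed.

Lemma FStepP c d k x y u v : x < 3 -> nu1 x = Some u -> nu1 y = Some v ->
  sat nu1 nu2 (FStep c d k x y) <->
  nu2 (yvar c d k) u /\ lstep w (c.1, val u) k (d.1, val v).
Proof.
move=> x3 Ex Ey; rewrite /FStep !sat_And sat_Bool (FMoveP _ Ex Ey) [sat _ _ (FIn _ _ _ _)]/= Ex.
have -> : sat nu1 nu2 (if k.2 then FSym (ins_sym (ins_of k)) x else FNot (FSym (ins_sym (ins_of k)) x))
   <-> (tape w (val u) = ins_sym (ins_of k) <-> k.2).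
  have := FSymP (ins_sym (ins_of k)) x3 Ex; case: (k.2) => H.
    by rewrite H; split=> [|[_]]; [split|apply].
  by rewrite sat_Not H; split=> [|[H1 _] /H1].
split=> [[[H1 /andP[/eqP H2 /eqP H3]] [H4 H5]]|[H1 [/= H2 H3 H4 H5 _]]].
  by split=> //; split=> //; apply: pos_bound.
by rewrite H2 H3 !eqxx.
Qed.

End Sem.
Arguments FSymP {w nu1 nu2 s} x u _ _.
Arguments FStepP {w nu1 nu2 c d k} x y u v _ _ _.

(** The first node of a path has no predecessor and the last one no successor, so the domain formula
    makes them initial and final; the edges in between are steps. *)
Lemma trace_sound w t : mso_rel T_trace (ed (endmark w)) (ed t) -> gsm_rel M w (hom trout t).
Proof.
case=> nu [dom /is_outputP[F [F1 F2 F3]]].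
pose cf (s : gV (ed t)) : conf M := ((F s).2.1, val (F s).1).
have E s s' k : gE (ed t) s k s' <->
    nu (yvar (F s).2 (F s').2 k) (F s).1 /\ lstep w (cf s) k (cf s').
  by rewrite F3; apply: (FStepP 0 1).
have N s : nu (xvar (F s).2) (F s).1 by apply/(F2 (F s).1 (F s).2); exists s; case: (F s).
have N' u c : nu (xvar c) u -> exists s, F s = (u, c) by move=> H; apply/F2.
have dm s : sat (upd (@asg0 _) 0 (Some (F s).1)) nu (FAnd (FOr (FAnd (FBool ((F s).2.1 == q_in M)) (FSym LEnd 0))
                (FOrs (fun dk : trcopy * trlabel => FEx1 1 (FAnd (FIn _ _ 1 (xvar dk.1)) (FStep dk.1 (F s).2 dk.2 1 0)))))
           (FOr (FBool ((F s).2.1 == q_f M))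
                (FOrs (fun dk : trcopy * trlabel => FEx1 1 (FAnd (FIn _ _ 1 (xvar dk.1)) (FStep (F s).2 dk.1 dk.2 0 1)))))).
  by move/sat_Ands/(_ (F s).2)/sat_All1/(_ (F s).1)/sat_Imp: dom; apply; apply: N.
have Ci : cf ord0 = init_conf M.
  case/sat_And: (dm ord0) => /sat_Or[/sat_And[/sat_Bool/eqP Eq /(FSymP 0 (F ord0).1 isT erefl) Ht]|Ho] _.
    by move: Ht; rewrite /cf Eq tape_sym; case: (val _) => //= i; case: (onth w i).
  case/sat_Ors: Ho => -[d k] /sat_Ex1[u /sat_And[/N'[s Es] /(FStepP 1 0 u (F ord0).1 isT erefl erefl)]].
  by have := E s ord0 k; rewrite {1}Es /cf Es /= => H /H.

have Cf : (cf ord_max).1 = q_f M.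
  case/sat_And: (dm ord_max) => _ /sat_Or[/sat_Bool/eqP //|].
  case/sat_Ors => -[d k] /sat_Ex1[u /sat_And[/N'[s Es] /(FStepP 0 1 (F ord_max).1 u isT erefl erefl)]].
  have := E ord_max s k; rewrite Es /cf Es => H /H.
  by rewrite edE /= => /andP[/eqP Hs]; have := ltn_ord s; rewrite [nat_of_ord s]Hs ltnn.
pose cs := [seq cf (inord i) | i <- iota 1 (size t)].
have Hc i : i <= size t -> nth (init_conf M) (init_conf M :: cs) i = cf (inord i).
  case: i => [_|i Hi] /=; first by rewrite -Ci; congr cf; apply: val_inj; rewrite /= inordK.
  by rewrite (nth_map 0) ?size_iota // nth_iota.
exists cs; split.
  apply/comp_trace; exists t; split=> //; first by rewrite size_map size_iota.
  move=> i k Hi; have Hit : i < size t by rewrite ltnNge; apply/negP => H; rewrite onth_default in Hi.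
  rewrite !Hc // 1?ltnW //; have [] := (E (inord i) (inord i.+1) k).1 => //.
  by rewrite edE /= !inordK ?Hi ?eqxx // ltnS ltnW.
rewrite (last_nth (init_conf M)) size_map size_iota Hc // -Cf; congr (cf _).1.
by apply: val_inj; rewrite /= inordK.
Qed.

(** Time [s] is given the number of earlier visits to its position. This number is at most [K] and
    increases from one visit of a position to the next, so that distinct times become distinct
    nodes. *)
Lemma trace_complete w cs z :
  successful (M := M) w cs z -> k_visiting K cs ->
  exists2 t, mso_rel T_trace (ed (endmark w)) (ed t) & z = hom trout t.
Proof.
case=> /comp_trace[t [st -> Ht]] Hf Hk; exists t => //.
pose c0 := init_conf M; pose C := c0 :: cs; pose cn s := nth c0 C s.
have sC : size C = (size t).+1 by rewrite /= st.
pose vis s := count (fun c : conf M => c.2 == (cn s).2) (take s C).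
have visK s : s <= size t -> vis s <= K.
  move=> Hs; apply: leq_trans (Hk (cn s).2); rewrite -[X in _ <= count _ X](cat_take_drop s) count_cat.
  exact: leq_addr.
have bnd s : s <= size t -> (cn s).2 <= (size w).+1.
  case: s => // s Hs; have [k Ek] := onth_size Hs.
  by have [] := Ht _ _ Ek.
have vis_lt s s' : s < s' -> s' <= size t -> (cn s).2 = (cn s').2 -> vis s < vis s'.
  move=> ss Hs' E; rewrite /vis -E.
  have -> : take s' C = take s C ++ drop s (take s' C).
    by rewrite -[LHS](cat_take_drop s) take_takel ?(ltnW ss).
  rewrite count_cat -[X in X < _]addn0 ltn_add2l -has_count.
  apply/hasP; exists (cn s); last exact: eqxx.
  have Hss : s < size (take s' C) by rewrite size_takel // sC leqW.
  by rewrite (drop_nth c0) // nth_take // mem_head.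
have vis_inj s s' : s <= size t -> s' <= size t -> (cn s).2 = (cn s').2 -> vis s = vis s' -> s = s'.
  move=> Hs Hs' E Ev; case: (ltngtP s s') => // ss; first by have := vis_lt _ _ ss Hs' E; rewrite Ev ltnn.
  by have := vis_lt _ _ ss Hs (esym E); rewrite Ev ltnn.
have sE : size (endmark w) = (size w).+1 by rewrite size_rcons size_map.
pose F (s : gV (ed t)) : gV (ed (endmark w)) * trcopy :=
  (inord (cn (val s)).2, ((cn (val s)).1, inord (vis (val s)))).
have Hsz (s : gV (ed t)) : val s <= size t by have := ltn_ord s.
have Fp s : val (F s).1 = (cn (val s)).2 by rewrite /F /= inordK // sE ltnS; exact: bnd (Hsz s).
have Fv s : val (F s).2.2 = vis (val s) by rewrite /F /= inordK // ltnS; exact: visK (Hsz s).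
have Finj : injective F.
  by move=> s s' E; apply/val_inj/vis_inj; rewrite // -?Fp -?Fv E.
pose X c (u : gV (ed (endmark w))) := `[< exists s, F s = (u, c) >].
pose Y c d k (u : gV (ed (endmark w))) :=
  `[< exists s s', [/\ F s = (u, c), (F s').2 = d & gE (ed t) s k s'] >].
pose nu n := match unpickle n : option (trcopy + trcopy * trcopy * trlabel) with
  | Some (inl c) => X c | Some (inr (c, d, k)) => Y c d k | None => fun _ => false end.
have nX c u : nu (xvar c) u <-> exists s, F s = (u, c).
  by rewrite /nu /xvar pickleK; split=> /asboolP.
have nY c d k u : nu (yvar c d k) u <->
    exists s s', [/\ F s = (u, c), (F s').2 = d & gE (ed t) s k s'].
  by rewrite /nu /yvar pickleK; split=> /asboolP.
have L s k s' : gE (ed t) s k s' -> lstep w ((F s).2.1, val (F s).1) k ((F s').2.1, val (F s').1).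
  rewrite edE => /andP[/eqP E1 /eqP E2]; rewrite !Fp -!surjective_pairing E1.
  by have := Ht _ _ E2.
have EY s k s' : gE (ed t) s k s' -> nu (yvar (F s).2 (F s').2 k) (F s).1.
  by move=> E; apply/nY; exists s, s'; case: (F s) E.
exists nu; split; last (apply/is_outputP; exists F; split=> //).
- apply/sat_Ands => c; apply/sat_All1 => u; apply/sat_Imp => /nX[s Es].
  apply/sat_And; split; apply/sat_Or.
  + case E: (val s) => [|i]; [left|right].
      apply/sat_And; split; first by apply/sat_Bool; rewrite -[c]/(u, c).2 -Es /= E.
      apply/(FSymP 0 u isT erefl); rewrite -[u]/(u, c).1 -Es.
      by rewrite Fp E.
    have Hi : i < size t by rewrite -E.
    have [k Ek] := onth_size Hi.
    have Hg : gE (ed t) (inord i) k s by rewrite edE /= inordK ?E ?Ek ?eqxx // ltnW.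
    apply/sat_Ors; exists ((F (inord i)).2, k); apply/sat_Ex1; exists (F (inord i)).1.
    apply/sat_And; split; first by apply/nX; exists (inord i); case: (F _).
    apply/(FStepP 1 0 (F (inord i)).1 u isT erefl erefl).
    by have := L _ _ _ Hg; have := EY _ _ _ Hg; rewrite Es.
  + case: (ltngtP (val s) (size t)) (Hsz s) => // [Hi _|E _]; [right|left].
      have [k Ek] := onth_size Hi.
      have Hg : gE (ed t) s k (inord (val s).+1) by rewrite edE /= inordK ?Ek ?eqxx.
      set s' := inord _ in Hg.
      apply/sat_Ors; exists ((F s').2, k); apply/sat_Ex1; exists (F s').1.
      apply/sat_And; split; first by apply/nX; exists s'; case: (F _).
      apply/(FStepP 0 1 u (F s').1 isT erefl erefl).
      by have := L _ _ _ Hg; have := EY _ _ _ Hg; rewrite Es.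
    apply/sat_Bool; rewrite -[c]/(u, c).2 -Es /= E /cn -Hf (last_nth c0) -[size cs]st.
    by rewrite eqxx.
- by move=> u c; rewrite -nX.
- move=> s s' k; apply: (iff_trans _ (iff_sym (FStepP 0 1 (F s).1 (F s').1 isT erefl erefl))); split=> [E|].
    by split; [apply: EY|apply: L].
  (* The label [k] fixes the move and hence the position of the target; together with the copy
     recorded in [yvar] this identifies [s'] with [s2]. *)
  case=> /nY[s1 [s2 [E1 E2 Hg]]] [_ _ _ Hm _].
  have {E1}E1 : s1 = s by apply: Finj; rewrite E1; case: (F s).
  rewrite {s1}E1 in Hg; suff -> : s' = s2 by [].
  have [_ _ _ Hm2 _] := L _ _ _ Hg.
  apply: Finj; have: (F s').1 = (F s2).1.
    apply: val_inj; move: Hm Hm2 => /=; case: (trmove k) => /=.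
    - by move=> -> [->].
    - by move=> -> ->.
    - by move=> -> ->.
  by move: E2; case: (F s') => ? ?; case: (F s2) => ? ? /= -> ->.
Qed.
End Trace.

Lemma NGSM_fv_string_mso (S1 S2 : finType) (m : strans S1 S2) : NGSM_fv m -> string_mso m.
Proof.
case=> M [[k Hk] HM].
pose m2 : strans (option S1) (trlabel M) := fun v t => mso_rel (T_trace M k) (ed v) (ed t).
have S2' : string_mso m2 by exists (T_trace M k).
apply: string_mso_ext (string_mso_comp (string_mso_comp (string_mso_endmark S1) S2')
   (string_mso_hom (@trout _ _ M))) => w z; rewrite HM; split.
  by case=> t [[v [-> /trace_sound]]] H ->.
move=> /Hk[cs [Hsz /(trace_complete Hsz)[t Ht ->]]].
by exists t; split=> //; exists (endmark w).
Qed.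

(** * From formulas to automata *)

Record dfa (L : Type) := Dfa {
  dst : finType; dini : dst; dstep : dst -> L -> dst; dacc : dst -> bool }.
Arguments dini {L} d.
Arguments dstep {L} d _ _.
Arguments dacc {L} d _.

Section Dfa.
Variable L : Type.
Implicit Types (s : seq L) (X Y : dfa L).

Definition drun X := foldl (dstep X).
Arguments drun : clear implicits.
Definition lang X s := dacc X (drun X (dini X) s).
Arguments lang : clear implicits.

Definition dcompl X := @Dfa L (dst X) (dini X) (dstep X) (fun q => ~~ dacc X q).

Lemma lang_compl X s : lang (dcompl X) s = ~~ lang X s.
Proof. by []. Qed.

Definition dprod (op : bool -> bool -> bool) X Y := @Dfa L (dst X * dst Y)%type
  (dini X, dini Y) (fun q a => (dstep X q.1 a, dstep Y q.2 a))
  (fun q => op (dacc X q.1) (dacc Y q.2)).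

Lemma lang_prod op X Y s : lang (dprod op X Y) s = op (lang X s) (lang Y s).
Proof.
rewrite /lang; suff -> : forall q, drun (dprod op X Y) q s = (drun X q.1 s, drun Y q.2 s) by [].
by elim: s => [|a s IH] [q r] //=; rewrite IH.
Qed.

Definition dhas (p : L -> bool) := @Dfa L bool false (fun q a => q || p a) id.

Lemma lang_has p s : lang (dhas p) s = has p s.
Proof.
rewrite /lang /=; suff H q : drun (dhas p) q s = q || has p s by rewrite H.
by elim: s q => [|a s IH] q /=; rewrite ?orbF // IH orbA.
Qed.

(** [None] is the sink reached at a second occurrence. *)
Definition dexactly1 (p : L -> bool) := @Dfa L (option bool) (Some false)
  (fun q a => if p a then (if q == Some false then Some true else None) else q)
  (fun q => q == Some true).

Lemma lang_one p s : lang (dexactly1 p) s = (count p s == 1).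
Proof.
rewrite /lang; pose c n := match n with 0 => Some false | 1 => Some true | _ => None end.
suff H n : drun (dexactly1 p) (c n) s = c (n + count p s).
  by rewrite (H 0) /=; case: (count p s) => [|[]].
elim: s n => [|a s IH] n /=; first by rewrite addn0.
case: (p a); last by rewrite IH.
by rewrite add1n -addSnnS -IH; case: n => [|[]].
Qed.

Definition dadj (p1 p2 : L -> bool) := @Dfa L (bool * bool)%type (false, false)
  (fun q a => (p1 a, q.2 || q.1 && p2 a)) snd.

Lemma lang_adj p1 p2 (F : nat -> L) n :
  lang (dadj p1 p2) (map F (iota 0 n)) <-> exists i, [/\ i.+1 < n, p1 (F i) & p2 (F i.+1)].
Proof.
rewrite /lang; set q := drun _ _ _.
suff : q.1 = (0 < n) && p1 (F n.-1) /\ (q.2 <-> exists i, [/\ i.+1 < n, p1 (F i) & p2 (F i.+1)]).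
  by case.
rewrite {}/q; elim: n => [|n]; first by split=> //; split=> // -[i []].
have -> : iota 0 n.+1 = rcons (iota 0 n) n by rewrite -addn1 iotaD cats1.
rewrite map_rcons /drun foldl_rcons /=.
set q := foldl _ _ _; case=> E1 E2; split=> //; rewrite E1.
split=> [/orP[/E2[i [Hi H1 H2]]|/andP[/andP[n0 H1] H2]]|[i [Hi H1 H2]]].
- by exists i; split=> //; apply: ltnW.
- by exists n.-1; rewrite prednK.
move: Hi; rewrite ltnS leq_eqVlt => /predU1P[<-|Hi]; first by rewrite /= H1 H2 orbT.
by apply/orP; left; apply/E2; exists i.
Qed.

(** The subset construction guesses the track of bits that [ext] writes into the letters. *)
Definition dproj (ext : bool -> L -> L) X := @Dfa L {set dst X} [set dini X]
  (fun S a => [set q | [exists r in S, [exists b, dstep X r (ext b a) == q]]])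
  (fun S => [exists q in S, dacc X q]).

Lemma lang_proj ext X (F : nat -> L) n :
  lang (dproj ext X) (map F (iota 0 n)) <->
  exists beta : nat -> bool, lang X [seq ext (beta i) (F i) | i <- iota 0 n].
Proof.
rewrite /lang.
suff H q : q \in drun (dproj ext X) [set dini X] (map F (iota 0 n)) <->
    exists beta : nat -> bool, drun X (dini X) [seq ext (beta i) (F i) | i <- iota 0 n] = q.
  split=> [/exists_inP[q /H[beta Eq]]|[beta Hb]]; first by exists beta; rewrite Eq.
  by apply/exists_inP; eexists; [apply/H; exists beta|].
elim: n q => [|n IH] q; first by rewrite inE; split=> [/eqP->|[beta <-]] //; exists (fun _ => false).
have D G : [seq G i | i <- iota 0 n.+1] = rcons [seq G i | i <- iota 0 n] (G n) :> seq L.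
  by rewrite -addn1 iotaD map_cat cats1.
rewrite D /drun foldl_rcons inE; split=> [/exists_inP[r /IH[beta Er] /existsP[b /eqP Eq]]|[beta]].
  exists (upd beta n b); rewrite D foldl_rcons /upd eqxx -Eq -Er; congr (dstep _ (foldl _ _ _) _).
  by apply/eq_in_map => i; rewrite mem_iota add0n => /andP[_ /ltn_eqF ->].
rewrite D foldl_rcons => Eq; apply/exists_inP; eexists; first by apply/IH; exists beta.
by apply/existsP; exists (beta n); apply/eqP.
Qed.

End Dfa.
Arguments lang {L} X s : simpl never.

Section FormulaDfa.
Variable A : finType.

(* A letter describes a node: the label of its incoming edge ([None] at the
   first node), the node variables that denote it, the set variables containing it. *)
Definition letter : Type := (option A * (nat -> bool) * (nat -> bool))%type.

(** A node quantifier is a set quantifier restricted to singletons, whence the product with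
    [dexactly1]. An unassigned variable marks no letter, so that its atoms fail as in [sat]. *)
Fixpoint dfa_of (f : mso unit A) : dfa letter :=
  match f with
  | FLab _ x => dhas (fun a : letter => a.1.2 x)
  | FEdge c x y => dadj (fun a : letter => a.1.2 x)
                        (fun a : letter => a.1.2 y && (a.1.1 == Some c))
  | FEq x y => dhas (fun a : letter => a.1.2 x && a.1.2 y)
  | FIn x X => dhas (fun a : letter => a.1.2 x && a.2 X)
  | FNot f => dcompl (dfa_of f)
  | FAnd f1 f2 => dprod andb (dfa_of f1) (dfa_of f2)
  | FOr f1 f2 => dprod orb (dfa_of f1) (dfa_of f2)
  | FEx1 x f => dproj (fun b (a : letter) => (a.1.1, upd a.1.2 x b, a.2))
                  (dprod andb (dexactly1 (fun a : letter => a.1.2 x)) (dfa_of f))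
  | FEx2 X f => dproj (fun b (a : letter) => (a.1.1, a.1.2, upd a.2 X b)) (dfa_of f)
  end.

Definition nodelab (w : seq A) i := if i is i'.+1 then onth w i' else None.

Definition word (w : seq A) (b1 b2 : nat -> nat -> bool) : seq letter :=
  [seq (nodelab w i, b1 i, b2 i) | i <- iota 0 (size w).+1].
Arguments word : simpl never.

Lemma lang_dfa_of f (w : seq A) (b1 b2 : nat -> nat -> bool)
    (nu1 : nat -> option (gV (ed w))) (nu2 : nat -> gV (ed w) -> bool) :
  (forall i x, i < (size w).+1 -> b1 i x = (omap (@nat_of_ord _) (nu1 x) == Some i)) ->
  (forall (u : gV (ed w)) X, b2 (val u) X = nu2 X u) ->
  lang (dfa_of f) (word w b1 b2) <-> sat nu1 nu2 f.
Proof.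
elim: f b1 b2 nu1 nu2 => [[] x|c x y|x y|x X|f IH|f1 IH1 f2 IH2|f1 IH1 f2 IH2|x f IH|X f IH]
  b1 b2 nu1 nu2 H1 H2 /=.
- rewrite lang_has /word has_map; split=> [/hasP[i]|].
    rewrite mem_iota add0n => /andP[_ Hi] /=; rewrite H1 //; by case: (nu1 x).
  case E: (nu1 x) => [u|] // _; apply/hasP; exists (val u).
    by rewrite mem_iota add0n; exact: ltn_ord.
  by rewrite /= H1 ?E //; exact: ltn_ord.
- rewrite lang_adj; split=> [[i [Hi]]|].
    by rewrite /= !H1 // 1?ltnW //; case: (nu1 x) => //= u /eqP[<-]; case: (nu1 y) => //=.
  case Ex: (nu1 x) => [u|] //; case Ey: (nu1 y) => [v|] //.
  case/andP=> /eqP Ev Ec; exists (val u).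
  have Hu : (val u).+1 < (size w).+1 by rewrite -Ev; exact: ltn_ord.
  split=> //=; first by rewrite H1 ?Ex //; exact: ltn_ord.
  by rewrite H1 // Ey /= Ec andbT; apply/eqP; congr Some.
- rewrite lang_has /word has_map; split=> [/hasP[i]|].
    rewrite mem_iota add0n => /andP[_ Hi] /=; rewrite !H1 //; case: (nu1 x) => //= u /andP[/eqP[<-]].
    by case: (nu1 y) => //= v /eqP[E]; apply: val_inj.
  case E: (nu1 x) => [u|] //; case E': (nu1 y) => [v|] // uv; apply/hasP; exists (val u).
    by rewrite mem_iota add0n; exact: ltn_ord.
  by rewrite /= !H1 ?E ?E' ?uv /= ?eqxx //; exact: ltn_ord.
- rewrite lang_has /word has_map; split=> [/hasP[i]|].
    rewrite mem_iota add0n => /andP[_ Hi] /=; rewrite !H1 //; case: (nu1 x) => //= u /andP[/eqP[<-]].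
    by rewrite H2.
  case E: (nu1 x) => [u|] // uX; apply/hasP; exists (val u).
    by rewrite mem_iota add0n; exact: ltn_ord.
  by rewrite /= H1 ?E ?H2 ?uX /= ?eqxx //; exact: ltn_ord.
- rewrite lang_compl -(IH _ _ _ _ H1 H2); by split=> /negP.
- by rewrite lang_prod -(IH1 _ _ _ _ H1 H2) -(IH2 _ _ _ _ H1 H2); split=> /andP.
- by rewrite lang_prod -(IH1 _ _ _ _ H1 H2) -(IH2 _ _ _ _ H1 H2); split=> /orP.
- rewrite lang_proj.
  have C beta : count (fun a : letter => a.1.2 x)
      [seq (nodelab w i, upd (b1 i) x (beta i), b2 i) | i <- iota 0 (size w).+1] =
      count beta (iota 0 (size w).+1).
    by rewrite count_map; apply: eq_count => i /=; rewrite /upd eqxx.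
  have R beta (u : gV (ed w)) : (forall i, i < (size w).+1 -> beta i = (i == val u)) ->
      lang (dfa_of f) (word w (fun i => upd (b1 i) x (beta i)) b2) <->
      sat (upd nu1 x (Some u)) nu2 f.
    move=> Hb; apply: IH => // i y Hi; rewrite /upd; case: eqP => _; last exact: H1.
    by rewrite Hb // eq_sym.
  split=> [[beta]|[u Hu]].
    rewrite lang_prod lang_one C => /andP[/eqP Cb Hl].
    have : size (filter beta (iota 0 (size w).+1)) = 1 by rewrite size_filter.
    case E: (filter _ _) => [|k []] // _.
    have Hk i : i < (size w).+1 -> beta i = (i == k).
      by move=> Hi; rewrite -(mem_seq1 i k) -E mem_filter mem_iota add0n leq0n Hi !andbT.
    have : k \in [:: k] by rewrite mem_head.
    rewrite -E mem_filter mem_iota add0n => /andP[_ /andP[_ kw]].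
    by exists (Ordinal kw : gV (ed w)); apply/(R beta).
  exists (fun i => i == val u); rewrite lang_prod lang_one C; apply/andP; split.
    rewrite (eq_count (a2 := pred1 (val u))) // count_uniq_mem ?iota_uniq // mem_iota add0n.
    by rewrite (ltn_ord u : is_true (val u < (size w).+1)).
  exact/(R (fun i => i == val u)).
- rewrite lang_proj.
  have R beta (U : gV (ed w) -> bool) : (forall u, beta (val u) = U u) ->
      lang (dfa_of f) (word w b1 (fun i => upd (b2 i) X (beta i))) <->
      sat nu1 (upd nu2 X U) f.
    by move=> Hb; apply: IH => // u Y; rewrite /upd; case: eqP => _; [apply: Hb|apply: H2].
  split=> [[beta Hb]|[U HU]].
    by exists (fun u => beta (val u)); apply/(R beta).
  exists (fun i => if insub i is Some u then U u else false).
  apply: (R _ U _).2 HU => u /=.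
  by rewrite insubT; [exact: ltn_ord|move=> H; congr U; apply: val_inj].
Qed.

End FormulaDfa.

Section Family.
Variables (L : Type) (I : finType) (X : I -> dfa L).

(** All automata of a family run in parallel, so that one state per node serves every formula. *)
Definition dfam : finType := {dffun forall i, dst (X i)}.
Definition dfam_ini : dfam := [ffun i => dini (X i)].
Definition dfam_step (q : dfam) (a : L) : dfam := [ffun i => dstep (X i) (q i) a].
Definition dfam_acc i (q : dfam) := dacc (X i) (q i).

Lemma dfam_lang i s : dfam_acc i (foldl dfam_step dfam_ini s) = lang (X i) s.
Proof.
rewrite /dfam_acc /lang; congr dacc.
have -> : dini (X i) = dfam_ini i by rewrite ffunE.
elim: s dfam_ini => //= a s IH q.
by rewrite IH ffunE.
Qed.

End Family.

(** * Finite visit machines *)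

Lemma not_uniq_split (T : eqType) (s : seq T) :
  ~~ uniq s -> exists x s1 s2 s3, s = s1 ++ x :: s2 ++ x :: s3.
Proof.
elim: s => //= x s IH; rewrite negb_and negbK => /orP[/path.splitPr[s2 s3]|/IH[y [s1 [s2 [s3 ->]]]]].
  by exists x, [::], s2, s3.
by exists y, (x :: s1), s2, s3.
Qed.

Section Criterion.
Variables (S1 S2 : finType) (M : gsm S1 S2).
Local Notation comp := (@Defs.comp S1 S2 M).

Lemma comp_cat w c cs1 z1 cs2 z2 :
  comp w c cs1 z1 -> comp w (last c cs1) cs2 z2 -> comp w c (cs1 ++ cs2) (z1 ++ z2).
Proof.
elim=> {c cs1 z1} [//|c c' a cs z Hs _ IH] /= /IH H.
by rewrite -catA; apply: compS H.
Qed.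

Lemma comp_split w c cs1 cs2 z : comp w c (cs1 ++ cs2) z ->
  exists z1 z2, [/\ z = z1 ++ z2, comp w c cs1 z1 & comp w (last c cs1) cs2 z2].
Proof.
elim: cs1 c z => [|c' cs1 IH] c z /= H; first by exists [::], z; split=> //; constructor.
inversion H as [|? ? a ? z' Hs Hc]; subst.
have [z1 [z2 [-> H1 H2]]] := IH _ _ Hc.
by exists (a ++ z1), z2; rewrite catA; split=> //; apply: compS H1.
Qed.

Definition silent_loops := forall w c cs0 z0 cs1 z1 cs2 z2,
  comp w (init_conf M) cs0 z0 -> last (init_conf M) cs0 = c ->
  comp w c cs1 z1 -> last c cs1 = c ->
  comp w c cs2 z2 -> (last c cs2).1 = q_f M -> z1 = [::].

(* Loops of a successful computation that write nothing can be cut out. *)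
Lemma silent_loops_fv : silent_loops -> finite_visit M.
Proof.
(* Once no configuration repeats, a position is visited at most once in each state. *)
move=> sl; exists #|gQ M| => w z [cs Hcs].
have [cs' [Hc' Hu]] : exists cs', successful w cs' z /\ uniq (init_conf M :: cs').
  have [n] := ubnP (size cs); elim: n cs Hcs => // n IH cs Hcs Hn.
  have [Hu|/not_uniq_split[x [s1 [s2 [s3 E]]]]] := boolP (uniq (init_conf M :: cs)).
    by exists cs.
  have [cs0 [Ecs El]] : exists cs0, cs = cs0 ++ rcons s2 x ++ s3 /\ last (init_conf M) cs0 = x.
    case: s1 E => [|y s1] [-> ->]; first by exists [::]; rewrite cat_rcons.
    by exists (rcons s1 x); rewrite last_rcons cat_rcons cat_rcons.
  rewrite {E}Ecs in Hcs Hn; case: Hcs => /comp_split[z0 [z' [Ez H0 /comp_split[z1 [z2 [Ez' H1 H2]]]]]].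
  rewrite El last_rcons in H1 H2; rewrite !last_cat El last_rcons => Hf.
  rewrite Ez' (sl _ _ _ _ _ _ _ _ H0 El H1 (last_rcons _ _ _) H2 Hf) cat0s in Ez.
  apply: (IH (cs0 ++ s3)); first by rewrite Ez; split; [apply: comp_cat; rewrite ?El|rewrite last_cat El].
  rewrite ltnS in Hn; apply: leq_trans Hn; rewrite !size_cat size_rcons.
  by rewrite ltn_add2l ltnS leq_addl.
exists cs'; split=> // i; rewrite -size_filter -(size_map fst).
have U : uniq [seq c.1 | c <- [seq c <- init_conf M :: cs' | c.2 == i]].
  rewrite map_inj_in_uniq ?filter_uniq // => -[p j] [q k]; rewrite !mem_filter /=.
  by case/andP=> /eqP -> _ /andP[/eqP -> _] ->.
by move/card_uniqP: U => <-; apply: max_card.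
Qed.

(** Running with and without the loop gives two outputs of the same input; they are equal, and
    comparing lengths shows that the loop writes nothing. *)
Lemma functional_fv :
  (forall w z z', gsm_rel M w z -> gsm_rel M w z' -> z = z') -> finite_visit M.
Proof.
move=> fn; apply: silent_loops_fv => w c cs0 z0 cs1 z1 cs2 z2 H0 E0 H1 E1 H2 E2.
have R1 : gsm_rel M w (z0 ++ z1 ++ z2).
  exists (cs0 ++ cs1 ++ cs2); split; last by rewrite !last_cat E0 E1.
  by apply: comp_cat => //; rewrite E0; apply: comp_cat => //; rewrite E1.
have R2 : gsm_rel M w (z0 ++ z2).
  exists (cs0 ++ cs2); split; last by rewrite !last_cat E0.
  by apply: comp_cat => //; rewrite E0.
have := congr1 size (fn _ _ _ R1 R2); rewrite !size_cat => /addnI/eqP.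
by rewrite -[X in _ == X]add0n eqn_add2r => /nilP.
Qed.

(** The head advances by the number of letters written, so a loop, which returns to its position, is
    silent. *)
Lemma oneway_fv :
  (forall w c c' a, step (M := M) w c c' a -> c'.2 = c.2 + size a) -> finite_visit M.
Proof.
move=> H; apply: silent_loops_fv => w c cs0 z0 cs1 z1 cs2 z2 _ _ H1 E1 _ _.
have : (last c cs1).2 = c.2 + size z1.
  elim: H1 {E1} => [c1|c1 c' a cs z /H E _ IH]; first by rewrite addn0.
  by rewrite /= IH E size_cat addnA.
by rewrite E1 -[LHS]addn0 => /addnI/esym/size0nil.
Qed.

End Criterion.

(** * Machines given by a transition predicate *)

Section Machine.
Variables (S1 S2 Q : finType) (qi qf : Q).
Variable tr : Q -> tsym S1 -> Q -> option S2 -> dir -> bool.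

(** Finite codes of tape symbols and directions, over which [mdelta] enumerates the instructions. *)
Definition tsym_of (s : option (option S1)) : tsym S1 :=
  match s with None => LEnd | Some None => REnd | Some (Some a) => Sym a end.
Definition dir_of (e : option bool) : dir :=
  match e with None => MStay | Some true => MRight | Some false => MLeft end.
Definition oseq (a : option S2) : seq S2 := if a is Some b then [:: b] else [::].

Definition mdelta : seq (instr (option Q) S1 S2) :=
  [seq Instr (Some x.1.1.1.1) (tsym_of x.1.1.1.2) (Some x.1.1.2) (oseq x.1.2) (dir_of x.2)
             None [::] MStay
   | x <- [seq x <- enum {: Q * option (option S1) * Q * option S2 * option bool}
            | (x.1.1.1.1 != qf) && tr x.1.1.1.1 (tsym_of x.1.1.1.2) x.1.1.2 x.1.2 (dir_of x.2)]].

Lemma mdelta_wf : all (fun i => ins_p i != Some qf) mdelta.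
Proof. by rewrite all_map all_filter; apply/allP => x _ /=; apply/implyP => /andP[]. Qed.

(* The else-branch of each instruction leads to a dead state, which turns the
   test of the scanned symbol into a mere precondition. *)
Definition machine : gsm S1 S2 := @Gsm S1 S2 (option Q) (Some qi) (Some qf) mdelta mdelta_wf.

Definition mstep (w : seq S1) (c c' : Q * nat) (a : option S2) : Prop :=
  c.1 != qf /\ exists e, [/\ tr c.1 (tape w c.2) c'.1 a e, moves c.2 e c'.2 & c'.2 <= (size w).+1].

Inductive mrun (w : seq S1) : Q * nat -> seq S2 -> Prop :=
| mrun_nil i : mrun w (qf, i) [::]
| mrun_cons c c' a z : mstep w c c' a -> mrun w c' z -> mrun w c (oseq a ++ z).

Lemma mrun_inv w c z : mrun w c z -> (c.1 = qf /\ z = [::]) \/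
  exists c' a z', [/\ mstep w c c' a, mrun w c' z' & z = oseq a ++ z'].
Proof. by case=> [i|c' c'' a z' H1 H2]; [left|right; exists c'', a, z']. Qed.

Lemma inseq_map (A : eqType) B (f : A -> B) y s :
  inseq y (map f s) <-> exists2 x, x \in s & y = f x.
Proof.
elim: s => [|x s IH] /=; first by split=> // -[].
split=> [[<-|/IH[x' xs ->]]|[x']].
- by exists x; rewrite ?mem_head.
- by exists x'; rewrite // inE xs orbT.
- by rewrite inE => /predU1P[->|xs] E; [left|right; apply/IH; exists x'].
Qed.

(** The second alternative falls into the dead state [None], where no instruction starts; no
    successful computation takes it. *)
Lemma stepP w (c c' : conf machine) z : step w c c' z <->
  exists p, c.1 = Some p /\
    ((exists q a, [/\ c'.1 = Some q, z = oseq a & mstep w (p, c.2) (q, c'.2) a]) \/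
     [/\ c'.1 = None, z = [::], c'.2 = c.2, c.2 <= (size w).+1 &
         exists s q a e, [/\ p != qf, tr p s q a e & tape w c.2 <> s]]).
Proof.
case: c c' => [p i] [q j]; split=> [[ins /inseq_map[x]]|[{}p [/= -> [|]]]].
- rewrite mem_filter => /andP[/andP[xf xt] _] -> [/= <- H Hj].
  exists x.1.1.1.1; split=> //; case: H => -[Et [-> -> Hm]]; [left|right].
    by exists x.1.1.2, x.1.2; split=> //; split=> //; exists (dir_of x.2); rewrite /= Et.
  by split=> //; [rewrite -Hm|do 4!eexists; split; first exact: xf; [exact: xt|]].
- case=> {}q [a [-> -> [/= pf [e [Ht Hm Hj]]]]].
  have [s Es] : exists s, tsym_of s = tape w i.
    by case: (tape w i) => [||b]; [exists None|exists (Some None)|exists (Some (Some b))].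
  have [d Ed] : exists d, dir_of d = e.
    by case: e {Ht Hm}; [exists (Some false)|exists None|exists (Some true)].
  exists (Instr (Some p) (tsym_of s) (Some q) (oseq a) (dir_of d) None [::] MStay).
    apply/inseq_map; exists (p, s, q, a, d) => //.
    by rewrite mem_filter mem_enum /= pf Es Ed Ht.
  by split=> //=; left; rewrite Es Ed.
- case=> -> -> -> Hi [s [{}q [a [e [pf Ht Hs]]]]].
  have [s' Es] : exists s', tsym_of s' = s.
    by case: s {Ht Hs} => [||b]; [exists None|exists (Some None)|exists (Some (Some b))].
  have [d Ed] : exists d, dir_of d = e.
    by case: e {Ht}; [exists (Some false)|exists None|exists (Some true)].
  exists (Instr (Some p) (tsym_of s') (Some q) (oseq a) (dir_of d) None [::] MStay).
    apply/inseq_map; exists (p, s', q, a, d) => //.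
    by rewrite mem_filter mem_enum /= pf Es Ed Ht.
  by split=> //=; right; rewrite Es.
Qed.

Lemma machine_rel w z : gsm_rel machine w z <-> mrun w (qi, 0) z.
Proof.
split=> [[cs [Hc Hl]]|].
  have : forall c cs z, Defs.comp (M := machine) w c cs z -> (last c cs).1 = Some qf ->
      exists2 p, c.1 = Some p & mrun w (p, c.2) z.
    move=> {cs z Hc Hl} c cs z; elim=> {c cs z} [[p i] /= ->|c c' a cs z /stepP[p [Ep H]] _ IH /IH].
      by exists qf => //; constructor.
    case=> q Eq Hq; exists p => //; case: H => [[q' [b [Eq' -> Hs]]]|[]]; last by rewrite Eq.
    by apply: mrun_cons Hs _; move: Eq'; rewrite Eq => -[<-].
  by case/(_ _ _ _ Hc Hl) => p [<-].
have H c : mrun w c z -> exists cs, Defs.comp (M := machine) w (Some c.1, c.2) cs z /\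
    (last (Some c.1, c.2) cs).1 = Some qf.
  elim=> {c z} [i|c c' a z Hs _ [cs [Hc Hl]]]; first by exists [::]; split=> //; constructor.
  exists ((Some c'.1, c'.2) :: cs); split=> //; apply: compS Hc.
  by apply/stepP; exists c.1; split=> //; left; exists c'.1, a; split=> //; case: c c' Hs {Hl} => ? ? [].
by case/H => cs Hc; exists cs.
Qed.

End Machine.

(** * Annotated words *)

Section Marks.
Variables (A I : finType) (fam : I -> mso unit A) (N : nat).

Definition bits : finType := {ffun 'I_N -> bool}.
(** Set variables from [N] on are read as empty, so that finitely many bits give a total
    valuation. *)
Definition bit (P : bits) (X : nat) : bool := if insub X is Some j then P j else false.
Definition base : finType := (option A * bits)%type.

Definition St : finType := dfam (fun i => dfa_of (fam i)).
Definition st0 : St := dfam_ini (fun i => dfa_of (fam i)).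
Definition acc i (q : St) : bool := dfam_acc i q.

(* The two booleans tell whether the node is denoted by variable 0, resp. 1. *)
Definition mletter (x : base) (mx my : bool) : letter A :=
  (x.1, fun k => (k == 0) && mx || (k == 1) && my, bit x.2).
Definition dlt mx my (x : base) (q : St) : St := dfam_step q (mletter x mx my).

Section Runs.
Variable beta : nat -> base.

Definition run m k (q : St) : St := foldl (fun q i => dlt false false (beta i) q) q (index_iota m k).

Lemma run0 m q : run m m q = q.
Proof. by rewrite /run /index_iota subnn. Qed.

Lemma run_first m k q : m < k -> run m k q = run m.+1 k (dlt false false (beta m) q).
Proof. by move=> mk; rewrite /run /index_iota -(subnSK mk). Qed.

Lemma run_last m k q : m <= k -> run m k.+1 q = dlt false false (beta k) (run m k q).
Proof.
move=> mk; rewrite /run /index_iota subSn // -addn1 iotaD foldl_cat /=.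
by rewrite subnKC.
Qed.

Definition mrunm (mx my : nat -> bool) m k (q : St) : St :=
  foldl (fun q i => dlt (mx i) (my i) (beta i) q) q (index_iota m k).

Lemma mrunm_cat mx my m k l q : m <= k -> k <= l ->
  mrunm mx my m l q = mrunm mx my k l (mrunm mx my m k q).
Proof.
move=> mk kl; rewrite /mrunm -foldl_cat; congr foldl; rewrite /index_iota.
rewrite -[X in _ ++ iota X _](subnKC mk) -iotaD; congr iota.
by rewrite addnC addnBA // subnK.
Qed.

Lemma mrunm1 mx my m q : mrunm mx my m m.+1 q = dlt (mx m) (my m) (beta m) q.
Proof. by rewrite /mrunm /index_iota subSnn. Qed.

Lemma mrunm_run mx my m k q :
  (forall i, m <= i < k -> mx i = false /\ my i = false) -> mrunm mx my m k q = run m k q.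
Proof.
move=> H; rewrite /mrunm /run; have {}H : {in index_iota m k, forall i, mx i = false /\ my i = false}.
  by move=> i; rewrite mem_index_iota; apply: H.
elim: (index_iota m k) q H => //= i s IH q H.
have [-> ->] := H i (mem_head _ _); apply: IH => j js.
by apply: H; rewrite inE js orbT.
Qed.

Variable n : nat.
(** The annotation stores [pre] and [suf]. With the source [u] marked, [mid u v] is the state before
    a later node [v], carried by a walk to the right, and [smid v u] the transition function after
    an earlier node [v], carried by a walk to the left. *)
Definition pre i := run 0 i st0.
Definition suf i : {ffun St -> St} := [ffun q => run i n q].
Definition mid u v := run u.+1 v (dlt true false (beta u) (pre u)).
Definition smid v u : {ffun St -> St} :=
  [ffun q => suf u.+1 (dlt true false (beta u) (run v.+1 u q))].

Lemma pre_S u : pre u.+1 = dlt false false (beta u) (pre u).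
Proof. exact: run_last. Qed.

Lemma mid_first u : mid u u.+1 = dlt true false (beta u) (pre u).
Proof. exact: run0. Qed.

(** Here and in [smid_P], one step of a walk only needs the letter under the head. *)
Lemma mid_S u v : u < v -> mid u v.+1 = dlt false false (beta v) (mid u v).
Proof. exact: run_last. Qed.

Lemma smid_first u : smid u u.+1 = [ffun q => suf u.+2 (dlt true false (beta u.+1) q)].
Proof. by apply/ffunP => q; rewrite !ffunE run0. Qed.

Lemma smid_pred u : 0 < u -> smid u.-1 u = [ffun q => suf u.+1 (dlt true false (beta u) q)].
Proof. by case: u => // u _; rewrite smid_first. Qed.

Lemma smid_P v u : v.+1 < u -> smid v u = [ffun q => smid v.+1 u (dlt false false (beta v.+1) q)].
Proof. by move=> vu; apply/ffunP => q; rewrite !ffunE (run_first _ vu). Qed.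

Lemma mark1 mx u : u < n -> (forall i, i < n -> mx i = (i == u)) ->
  mrunm mx (fun _ => false) 0 n st0 = suf u.+1 (dlt true false (beta u) (pre u)).
Proof.
move=> un H; rewrite (@mrunm_cat _ _ 0 u n) // ?(ltnW un) // (@mrunm_cat _ _ u u.+1 n) //.
rewrite mrunm1 H // eqxx ffunE !mrunm_run // => i /andP[Hi Hj]; split=> //; rewrite H //.
- by rewrite (ltn_eqF Hj).
- exact: ltn_trans un.
- by rewrite (gtn_eqF Hi).
Qed.

(** The run is cut at the two marked nodes. The three cases correspond to an edge that stays, goes
    right or goes left. *)
Lemma mark2 u v : u < n -> v < n ->
  mrunm (fun i => i == u) (fun i => i == v) 0 n st0 =
  if u == v then suf u.+1 (dlt true true (beta u) (pre u))
  else if u < v then suf v.+1 (dlt false true (beta v) (mid u v))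
  else smid v u (dlt false true (beta v) (pre v)).
Proof.
move=> un vn; case: eqP => [<-|/eqP uv].
  rewrite (@mrunm_cat _ _ 0 u n) // ?(ltnW un) // (@mrunm_cat _ _ u u.+1 n) //.
  rewrite mrunm1 eqxx ffunE !mrunm_run // => i /andP[Hi Hj].
  - by rewrite (ltn_eqF Hj).
  - by rewrite (gtn_eqF Hi).
case: ltnP => [lt|]; last rewrite leq_eqVlt eq_sym (negbTE uv) /= => lt.
  rewrite (@mrunm_cat _ _ 0 u n) // ?(ltnW un) // (@mrunm_cat _ _ u u.+1 n) //.
  rewrite (@mrunm_cat _ _ u.+1 v n) // ?(ltnW vn) // (@mrunm_cat _ _ v v.+1 n) //.
  rewrite !mrunm1 !eqxx (negbTE uv) eq_sym (negbTE uv) ffunE !mrunm_run // => i /andP[Hi Hj].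
  - by rewrite (ltn_eqF Hj) (ltn_eqF (ltn_trans Hj lt)).
  - by rewrite (ltn_eqF Hj) (gtn_eqF Hi).
  - by rewrite (gtn_eqF Hi) (gtn_eqF (ltn_trans lt Hi)).
rewrite (@mrunm_cat _ _ 0 v n) // ?(ltnW vn) // (@mrunm_cat _ _ v v.+1 n) //.
rewrite (@mrunm_cat _ _ v.+1 u n) // ?(ltnW un) // (@mrunm_cat _ _ u u.+1 n) //.
rewrite !mrunm1 !eqxx (negbTE uv) eq_sym (negbTE uv) !ffunE !mrunm_run // => i /andP[Hi Hj].
- by rewrite (ltn_eqF Hj) (ltn_eqF (ltn_trans Hj lt)).
- by rewrite (ltn_eqF Hj) (gtn_eqF Hi).
- by rewrite (gtn_eqF Hi) (gtn_eqF (ltn_trans lt Hi)).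
Qed.

(* Each node carries the state reached before it and the transition function of
   the part of the word that follows it, all nodes being unmarked. *)
Definition annot : seq (base * St * {ffun St -> St}) :=
  [seq (beta i, pre i, suf i.+1) | i <- iota 0 n].

End Runs.

Lemma run_ext beta beta' m k q :
  (forall i, m <= i < k -> beta i = beta' i) -> run beta m k q = run beta' m k q.
Proof.
move=> H; rewrite /run; have {}H : {in index_iota m k, beta =1 beta'}.
  by move=> i; rewrite mem_index_iota; apply: H.
elim: (index_iota m k) q H => //= i s IH q H.
rewrite H ?mem_head //; apply: IH => j js.
by apply: H; rewrite inE js orbT.
Qed.

Lemma annot_ext beta beta' n :
  (forall i, i < n -> beta i = beta' i) -> annot beta n = annot beta' n.
Proof.
move=> H; apply/eq_in_map => i; rewrite mem_iota add0n => /andP[_ Hi].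
rewrite H // /pre; congr (_, _, _); first by apply: run_ext => j /andP[_ ji]; apply: H; apply: ltn_trans Hi.
by apply/ffunP => q; rewrite !ffunE; apply: run_ext => j /andP[_]; apply: H.
Qed.

Section Sem.
Variables (w : seq A) (P : nat -> bits).
Definition bword i : base := (nodelab w i, P i).
Definition valuation (X : nat) (u : gV (ed w)) : bool := bit (P (val u)) X.
Local Notation n := (size w).+1.

Lemma sat_marks mx my (nu1 : nat -> option (gV (ed w))) i :
  (forall j x, j < n -> (x == 0) && mx j || (x == 1) && my j = (omap (@nat_of_ord _) (nu1 x) == Some j)) ->
  acc i (mrunm bword mx my 0 n st0) <-> sat nu1 valuation (fam i).
Proof.
move=> H; rewrite -(lang_dfa_of (b1 := fun j x => (x == 0) && mx j || (x == 1) && my j)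
  (b2 := fun j => bit (P j)) _ H) // -(dfam_lang (fun i => dfa_of (fam i))).
rewrite /mrunm /index_iota subn0 /word; suff -> : forall q s,
  foldl (@dfam_step _ _ (fun i => dfa_of (fam i))) q
    [seq (nodelab w j, fun x : nat => (x == 0) && mx j || (x == 1) && my j, bit (P j)) | j <- s] =
  foldl (fun q j => dlt (mx j) (my j) (bword j) q) q s by [].
by move=> q s; elim: s q => //= j s IH q; rewrite IH.
Qed.

Lemma sat_dom i : acc i (run bword 0 n st0) <-> sat (@asg0 _) valuation (fam i).
Proof.
rewrite -(@sat_marks (fun _ => false) (fun _ => false)) ?mrunm_run //.
by move=> j x _; rewrite !andbF.
Qed.

Lemma sat_un i (u : gV (ed w)) :
  acc i (suf bword n (val u).+1 (dlt true false (bword (val u)) (pre bword (val u)))) <->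
  sat (asg1 u) valuation (fam i).
Proof.
rewrite -(@mark1 _ n (fun j => j == val u)) //; last exact: ltn_ord.
apply: sat_marks => j x _; rewrite andbF orbF /asg1.
by case: x => [|x] //=; rewrite eq_sym.
Qed.

Lemma sat_bin i (u v : gV (ed w)) :
  acc i (if val u == val v then suf bword n (val u).+1 (dlt true true (bword (val u)) (pre bword (val u)))
    else if val u < val v then suf bword n (val v).+1 (dlt false true (bword (val v)) (mid bword (val u) (val v)))
    else smid bword n (val v) (val u) (dlt false true (bword (val v)) (pre bword (val v)))) <->
  sat (asg2 u v) valuation (fam i).
Proof.
rewrite -mark2; try exact: ltn_ord.
apply: sat_marks => j x _; rewrite /asg2.
by case: x => [|[|x]] //=; rewrite ?orbF eq_sym.
Qed.

End Sem.
End Marks.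

(** * From transductions to finite visit machines *)

(* [Check], [Back] verify the annotation and rewind, [Scan] looks for the first
   output node, [At c] is at copy [c] of the current node. Following an edge from
   copy [c] to copy [d] labelled [g], [WRight c d g q] carries the state [q]
   reached with the source node marked, [WLeft c d g f] the transition function
   [f] of the rest of the word with the source node marked. *)
Inductive wstate (C B S F : Type) :=
| Check of option (S * F) | Back | Scan | At of C
| WRight of C & C & B & S | WLeft of C & C & B & F | Fin.
Arguments Check {C B S F}. Arguments Back {C B S F}. Arguments Scan {C B S F}.
Arguments At {C B S F}. Arguments WRight {C B S F}. Arguments WLeft {C B S F}.
Arguments Fin {C B S F}.

Section WStateFin.
Variables C B S F : finType.
Definition wstate_code (p : wstate C B S F) :
    option (S * F) + 'I_3 + C + C * C * B * S + C * C * B * F :=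
  match p with
  | Check r => inl (inl (inl (inl r)))
  | Back => inl (inl (inl (inr (@Ordinal 3 0 isT))))
  | Scan => inl (inl (inl (inr (@Ordinal 3 1 isT))))
  | Fin => inl (inl (inl (inr (@Ordinal 3 2 isT))))
  | At c => inl (inl (inr c))
  | WRight c d g q => inl (inr (c, d, g, q))
  | WLeft c d g f => inr (c, d, g, f)
  end.
Definition wstate_decode (x : option (S * F) + 'I_3 + C + C * C * B * S + C * C * B * F) :
    wstate C B S F :=
  match x with
  | inl (inl (inl (inl r))) => Check r
  | inl (inl (inl (inr i))) => match val i with 0 => Back | 1 => Scan | _ => Fin end
  | inl (inl (inr c)) => At c
  | inl (inr (c, d, g, q)) => WRight c d g q
  | inr (c, d, g, f) => WLeft c d g f
  end.
Lemma wstate_codeK : cancel wstate_code wstate_decode.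
Proof. by case. Qed.
HB.instance Definition _ := Finite.copy (wstate C B S F) (can_type wstate_codeK).
End WStateFin.

Section Decomposition.
Variables (A B : finType) (T : mso_trans unit A unit B).
Local Notation C := (copies T).

(** The remaining variables go to 2, which is kept unassigned, as they are under [asg1] and
    [asg2]. *)
Definition nodeF (c : C) x := ren (fun i => if i == 0 then x else 2) id (phi_node T c tt).
Definition edgeF (c d : C) g x y :=
  ren (fun i => if i == 0 then x else if i == 1 then y else 2) id (phi_edge T c d g).

Definition famI : finType := option ((bool * C) + (C * C * B))%type.
Definition iend (b : bool) (c : C) : famI := Some (inl (b, c)).
Definition iedge (c d : C) g : famI := Some (inr (c, d, g)).

(** On a path, the nodes without outgoing, resp. incoming, edge are the last and the first node;
    [iend] selects them. An edge formula may also hold outside the output nodes, hence the node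
    tests for [iedge]. *)
Definition fam (i : famI) : mso unit A :=
  match i with
  | None => phi_dom T
  | Some (inl (b, c)) =>
      FAnd (nodeF c 0) (FNot (FEx1 1 (FOrs (fun dg : C * B => FAnd (nodeF dg.1 1)
        (if b then edgeF c dg.1 dg.2 0 1 else edgeF dg.1 c dg.2 1 0)))))
  | Some (inr (c, d, g)) => FAnd (nodeF c 0) (FAnd (nodeF d 1) (edgeF c d g 0 1))
  end.

Definition nbits := maxn (vb (phi_dom T)) (maxn (\max_(c : C) vb (phi_node T c tt))
  (\max_(x : C * C * B) vb (phi_edge T x.1.1 x.1.2 x.2))).

Section FamSem.
Variables (w : seq A) (z : seq B) (nu2 : nat -> gV (ed w) -> bool).
Variable F : gV (ed z) -> gV (ed w) * C.
Hypothesis HF : outby (T := T) (g := ed w) nu2 (h := ed z) F.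

Lemma nodeFP nu1 c x u : nu1 x = Some u -> nu1 2 = None ->
  sat nu1 nu2 (nodeF c x) <-> exists s, F s = (u, c).
Proof.
move=> Ex E2; rewrite sat_ren; case: HF => _ -> _; apply: sat_eqfun => // i.
by rewrite /asg1 /=; case: ifP.
Qed.

Arguments nodeFP nu1 c x u _ _ : clear implicits.

Lemma edgeFP nu1 x y s s' g : nu1 x = Some (F s).1 -> nu1 y = Some (F s').1 -> nu1 2 = None ->
  sat nu1 nu2 (edgeF (F s).2 (F s').2 g x y) <-> gE (ed z) s g s'.
Proof.
move=> Ex Ey E2; rewrite sat_ren; case: HF => _ _ ->; apply: sat_eqfun => // i.
by rewrite /asg2 /=; case: ifP => // _; case: ifP.
Qed.

Arguments edgeFP nu1 x y s s' g _ _ _ : clear implicits.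

Lemma fam_edge u v c d g : sat (asg2 u v) nu2 (fam (iedge c d g)) <->
  exists s s', [/\ F s = (u, c), F s' = (v, d) & gE (ed z) s g s'].
Proof.
split=> [/sat_And[/(nodeFP (asg2 u v) c 0 u erefl erefl)[s Es]]|[s [s' [Es Es' Hg]]]].
  move=> /sat_And[/(nodeFP (asg2 u v) d 1 v erefl erefl)[s' Es'] He]; exists s, s'; split=> //.
  by apply/(edgeFP (asg2 u v) 0 1); rewrite ?Es ?Es'.
apply/sat_And; split; first by apply/(nodeFP (asg2 u v) c 0 u); [| |exists s].
apply/sat_And; split; first by apply/(nodeFP (asg2 u v) d 1 v); [| |exists s'].
by have := edgeFP (asg2 u v) 0 1 s s' g; rewrite Es Es' => /(_ erefl erefl erefl) [_]; apply.
Qed.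

Lemma fam_end (b : bool) u c :
  sat (asg1 u) nu2 (fam (iend b c)) <-> F (if b then ord_max else ord0) = (u, c).
Proof.
have Fi : injective F by case: HF.
have E (s : gV (ed z)) v dg : F s = (u, c) ->
  sat (upd (asg1 u) 1 (Some v)) nu2 (FAnd (nodeF dg.1 1)
    (if b then edgeF c dg.1 dg.2 0 1 else edgeF dg.1 c dg.2 1 0)) <->
  exists2 s', F s' = (v, dg.1) & if b then gE (ed z) s dg.2 s' else gE (ed z) s' dg.2 s.
- move=> Es; rewrite sat_And (nodeFP _ dg.1 1 v) //.
  split=> [[[s' Es'] H]|[s' Es' H]].
    exists s' => //; case: b H => H.
      by apply/(edgeFP (upd (asg1 u) 1 (Some v)) 0 1); rewrite ?Es ?Es'.
    by apply/(edgeFP (upd (asg1 u) 1 (Some v)) 1 0); rewrite ?Es ?Es'.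
  split; first by exists s'.
  case: b H => H.
    by have := edgeFP (upd (asg1 u) 1 (Some v)) 0 1 s s' dg.2;
      rewrite Es Es' => /(_ erefl erefl erefl) [_]; apply.
  by have := edgeFP (upd (asg1 u) 1 (Some v)) 1 0 s' s dg.2;
    rewrite Es Es' => /(_ erefl erefl erefl) [_]; apply.
split=> [/sat_And[/(nodeFP (asg1 u) c 0 u erefl erefl)[s Es] /sat_Not H]|Es].
  suff -> : (if b then ord_max else ord0) = s by [].
  case Eb: b.
    case: (ltngtP (val s) (size z)) (ltn_ord s) => [Hs _|/leq_trans H1|Hs _].
    - have [g Eg] := onth_size Hs; case: H; pose s' : gV (ed z) := Ordinal (Hs : (val s).+1 < (size z).+1).
      apply/sat_Ex1; exists (F s').1; apply/sat_Ors; exists ((F s').2, g).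
      apply/(E s) => //; exists s'; first by case: (F s').
      by rewrite Eb edE /= Eg !eqxx.
    - by rewrite ltnS => /H1; rewrite ltnn.
    - exact/esym/val_inj.
  case Ev: (val s) => [|i]; first by apply: val_inj; rewrite Ev.
  have Hi : i < size z by rewrite -ltnS -Ev; exact: ltn_ord.
  have [g Eg] := onth_size Hi; case: H; pose s' : gV (ed z) := Ordinal (ltnW Hi : i < (size z).+1).
  apply/sat_Ex1; exists (F s').1; apply/sat_Ors; exists ((F s').2, g).
  apply/(E s) => //; exists s'; first by case: (F s').
  by rewrite Eb edE /= Ev Eg !eqxx.
apply/sat_And; split; first by apply/(nodeFP (asg1 u) c 0 u); [| |exists (if b then ord_max else ord0)].
apply/sat_Not => /sat_Ex1[v /sat_Ors[dg /(E _ _ _ Es)[s' _]]].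
case: (b) => //=.
by case/andP=> /eqP E'; have := ltn_ord s'; rewrite [nat_of_ord s']E' ltnn.
Qed.

End FamSem.

Local Notation St := (St fam).
Local Notation FF := {ffun St -> St}.
Local Notation G := (base A nbits * St * FF)%type.
Local Notation state := (wstate C B St FF).

(** [r] is what the previous letter announces: the state on arrival and the transition function from
    here on. Every letter but the first must have a label, so that the labels spell a word. *)
Definition check1 (r : option (St * FF)) (x : G) : bool :=
  match r with
  | None => (x.1.1.1 == None) && (x.1.2 == st0 fam)
  | Some (q, t) => [&& x.1.1.1 != None, x.1.2 == q & t == [ffun q => x.2 (dlt false false x.1.1 q)]]
  end.

(** Label, target copy and direction of the next edge are guessed at its source; the letter is
    written at the target, after the edge formula has been tested. At the right end, the announced
    function must be the identity and the state must accept the domain formula. *)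
Definition walker_tr (p : state) (s : tsym G) (q : state) (o : option B) (e : dir) : bool :=
  match p, s with
  | Check r, LEnd => match q, o, e with
      | Check None, None, MRight => r == None
      | _, _, _ => false end
  | Check r, Sym x => match q, o, e with
      | Check (Some r'), None, MRight => check1 r x && (r' == (dlt false false x.1.1 x.1.2, x.2))
      | _, _, _ => false end
  | Check (Some r), REnd => match q, o, e with
      | Back, None, MLeft => (r.2 == [ffun q => q]) && acc (fam := fam) None r.1
      | _, _, _ => false end
  | Back, Sym _ => match q, o, e with Back, None, MLeft => true | _, _, _ => false end
  | Back, LEnd => match q, o, e with Scan, None, MRight => true | _, _, _ => false end
  | Scan, Sym x => match q, o, e with
      | Scan, None, MRight => true
      | At c, None, MStay => acc (fam := fam) (iend false c) (x.2 (dlt true false x.1.1 x.1.2))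
      | _, _, _ => false end
  | At c, Sym x => match q, o, e with
      | Fin, None, MStay => acc (fam := fam) (iend true c) (x.2 (dlt true false x.1.1 x.1.2))
      | At d, Some g, MStay => acc (fam := fam) (iedge c d g) (x.2 (dlt true true x.1.1 x.1.2))
      | WRight c' d g r, None, MRight => (c' == c) && (r == dlt true false x.1.1 x.1.2)
      | WLeft c' d g f, None, MLeft => (c' == c) && (f == [ffun r => x.2 (dlt true false x.1.1 r)])
      | _, _, _ => false end
  | WRight c d g r, Sym x => match q, o, e with
      | At d', Some g', MStay => [&& d' == d, g' == g &
          acc (fam := fam) (iedge c d g) (x.2 (dlt false true x.1.1 r))]
      | WRight c' d' g' r', None, MRight => [&& c' == c, d' == d, g' == g & r' == dlt false false x.1.1 r]
      | _, _, _ => false end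
  | WLeft c d g f, Sym x => match q, o, e with
      | At d', Some g', MStay => [&& d' == d, g' == g &
          acc (fam := fam) (iedge c d g) (f (dlt false true x.1.1 x.1.2))]
      | WLeft c' d' g' f', None, MLeft =>
          [&& c' == c, d' == d, g' == g & f' == [ffun r => f (dlt false false x.1.1 r)]]
      | _, _, _ => false end
  | _, _ => false
  end.

Local Notation mrun2 := (@mrun G B state Fin walker_tr).
Local Notation mstep2 := (@mstep G B state Fin walker_tr).

Fixpoint valid (r : option (St * FF)) (s : seq G) : bool :=
  match s with
  | [::] => if r is Some r then (r.2 == [ffun q => q]) && acc (fam := fam) None r.1 else false
  | x :: s => check1 r x && valid (Some (dlt false false x.1.1 x.1.2, x.2)) s
  end.

Lemma tape_end (b : seq G) i : tape b i.+1 = if drop i b is x :: _ then Sym x else REnd.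
Proof. by []. Qed.

Lemma tr2_check r x q a e : walker_tr (Check r) (Sym x) q a e =
  match q, a, e with
  | Check (Some r'), None, MRight => check1 r x && (r' == (dlt false false x.1.1 x.1.2, x.2))
  | _, _, _ => false
  end.
Proof. by case: r. Qed.

(** Tape position [i.+1] holds letter [i] of [b], whence the shift. *)
Lemma mrun_check b r i z : i <= size b ->
  mrun2 b (Check r, i.+1) z <-> valid r (drop i b) /\ mrun2 b (Back, size b) z.
Proof.
have [k] := ubnP (size b - i); elim: k i r => // k IH i r Hk Hi.
case: (ltngtP i (size b)) Hi => // [Hi _|E _].
  have [x Ex] : exists x, drop i b = x :: drop i.+1 b.
    by case E: (drop i b) (size_drop i b) => [|x s] /=; [move/esym/eqP; rewrite subn_eq0 leqNgt Hi|
      exists x; rewrite -addn1 addnC -drop_drop E /= drop0].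
  have Hk' : size b - i.+1 < k by apply: leq_trans (ltn_sub2l Hi (ltnSn i)) _.
  rewrite Ex /=; have {}IH := IH i.+1 _ Hk' Hi; split=> [/mrun_inv[[]//|]|[/andP[H1 H2] H3]].
    case=> -[q j] [a [z' [[_ [e []]]]]]; rewrite tape_end Ex tr2_check /=.
    case: q => // -[] // r'; case: a => //; case: e => // /andP[-> /eqP ->] /= ->.
    by move=> _ H E; rewrite -E in H; exact: (IH _).1 H.
  rewrite -[z]/(oseq (None : option B) ++ z); apply: (mrun_cons (c' := (Check _, i.+2))); last exact: (IH _).2 (conj H2 H3).
  by split=> //; exists MRight; rewrite tape_end Ex tr2_check /= eqxx H1; split.
rewrite E drop_size; split=> [/mrun_inv[[]//|]|[]].
  case=> -[q j] [a [z' [[_ [e []]]]]]; rewrite tape_end drop_size /=.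
  case: r => // r; case: q => //; case: a => //; case: e => // -> [<-] _ H ->.
  by split.
case: r => // r /= H H'.
rewrite -[z]/(oseq (None : option B) ++ z); apply: mrun_cons H'.
by split=> //; exists MLeft; rewrite tape_end drop_size /= H; split.
Qed.

Lemma drop_annot (beta : nat -> base A nbits) n i : i < n -> drop i (annot fam beta n) =
  (beta i, pre fam beta i, suf fam beta n i.+1) :: drop i.+1 (annot fam beta n).
Proof.
move=> Hi; have Hi' : i < size (annot fam beta n) by rewrite size_map size_iota.
have x0 : G := (beta i, pre fam beta i, suf fam beta n i.+1).
by rewrite (drop_nth x0) // (nth_map 0) ?size_iota // nth_iota.
Qed.

Lemma valid_annot (w : seq A) (P : nat -> bits nbits) :
  acc (fam := fam) None (run (bword w P) 0 (size w).+1 (st0 fam)) ->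
  valid None (annot fam (bword w P) (size w).+1).
Proof.
set n := (size w).+1; set beta := bword w P => Ha.
have H i : 0 < i -> i <= n -> valid (Some (pre fam beta i, suf fam beta n i)) (drop i (annot fam beta n)).
  have [k] := ubnP (n - i); elim: k i => // k IH i Hk Hi.
  rewrite leq_eqVlt => /predU1P[->|Hin].
    rewrite drop_oversize ?size_map ?size_iota //= Ha andbT.
    by apply/eqP/ffunP => q; rewrite !ffunE run0.
  rewrite drop_annot // [valid _ _]/= -pre_S; apply/andP; split; last first.
    by apply: IH => //; apply: leq_trans (ltn_sub2l Hin (ltnSn i)) _.
  apply/and3P; split=> //=; last by apply/eqP/ffunP => q; rewrite !ffunE run_first.
  case: i Hi Hin {Hk} => // i _ Hin; rewrite /nodelab; have Hiw : i < size w by [].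
  by have [a ->] := onth_size Hiw.
rewrite -[annot _ _ _]drop0 drop_annot // [valid _ _]/= !eqxx /= -pre_S.
exact: H.
Qed.

Lemma all_some (X : eqType) (s : seq (option X)) : None \notin s -> exists w, s = map Some w.
Proof.
elim: s => [|[x|] s IH] //; first by exists [::].
by rewrite inE => /IH[w ->]; exists (x :: w).
Qed.

(** Local consistency determines the annotation: the transition functions are forced from the right
    end, where the function is the identity, and the states are forced from the initial state on the
    left. *)
Lemma valid_inv b : valid None b -> exists w (P : nat -> bits nbits),
  b = annot fam (bword w P) (size w).+1 /\
  acc (fam := fam) None (run (bword w P) 0 (size w).+1 (st0 fam)).
Proof.
pose x0 : G := ((None, [ffun=> false]), st0 fam, [ffun q => q]).
pose beta j := (nth x0 b j).1.1; pose n := size b.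
have H i q t : i <= n -> valid (Some (q, t)) (drop i b) ->
    [/\ t = suf fam beta n i, acc (fam := fam) None (run beta i n q) & forall j, i <= j -> j < n ->
      [/\ (beta j).1 != None, (nth x0 b j).1.2 = run beta i j q & (nth x0 b j).2 = suf fam beta n j.+1]].
- have [k] := ubnP (n - i); elim: k i q t => // k IH i q t Hk.
  rewrite leq_eqVlt => /predU1P[->|Hin].
    rewrite drop_oversize //= => /andP[/eqP -> Ha]; split; last by move=> j /leq_ltn_trans H /H; rewrite ltnn.
      by apply/ffunP => r; rewrite !ffunE run0.
    by rewrite run0.
  rewrite (drop_nth x0) // [valid _ _]/= => /andP[/and3P[H1 /eqP H2 /eqP H3]].
  have Hk' : n - i.+1 < k by apply: leq_trans (ltn_sub2l Hin (ltnSn i)) _.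
  move/(IH _ _ _ Hk' Hin) => [E1 E2 E3]; split.
  + by rewrite H3 E1; apply/ffunP => r; rewrite !ffunE [RHS]run_first.
  + by rewrite run_first // -H2.
  + move=> j; rewrite leq_eqVlt => /predU1P[<-|ij] jn; first by rewrite run0.
    by have [F1 F2 F3] := E3 j ij jn; split=> //; rewrite F2 H2 [RHS]run_first.
case Eb: {1}b => [|x b'] // /andP[/andP[/eqP B0 /eqP P0]].
have n0 : 0 < n by rewrite /n Eb.
have Ex : nth x0 b 0 = x by rewrite Eb.
have -> : b' = drop 1 b by rewrite Eb /= drop0.
move=> /(H 1 _ _ n0)[E1 E2 E3].
rewrite -Ex -/(beta 0) in B0 P0 E1 E2 E3 *.
(* Only the first letter lacks a label, so the other labels form the word [w]. *)
have [w Ew] : exists w, [seq (beta i.+1).1 | i <- iota 0 n.-1] = map Some w.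
  apply: all_some; apply/mapP => -[i]; rewrite mem_iota add0n => /andP[_ Hi].
  have [|/eqP + _ _ E] := E3 i.+1 isT; last by rewrite -E.
  by rewrite -[n]prednK.
have sw : (size w).+1 = n by have := congr1 size Ew; rewrite !size_map size_iota => <-; rewrite prednK.
pose P j := (beta j).2.
have bE j : j < n -> beta j = bword w P j.
  rewrite /bword /P => Hj; rewrite [LHS]surjective_pairing; congr (_, _).
  case: j Hj => [|j] Hj //=; rewrite onthE -Ew (nth_map 0) ?nth_iota ?size_iota //.
    by rewrite -ltnS prednK.
  by rewrite -ltnS prednK.
exists w, P; rewrite sw; split.
  rewrite -(annot_ext fam bE); apply: (eq_from_nth (x0 := x0)); first by rewrite size_map size_iota.
  move=> j Hj; rewrite (nth_map 0) ?size_iota // nth_iota // add0n.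
  case: j Hj => [|j] Hj.
    by rewrite [LHS]surjective_pairing [(nth x0 b 0).1]surjective_pairing E1 P0 /pre run0.
  have [_ F2 F3] := E3 j.+1 isT Hj.
  by rewrite [LHS]surjective_pairing [(nth x0 b _).1]surjective_pairing F2 F3 /pre [in RHS]run_first // -P0.
rewrite -(@run_ext _ _ _ _ beta); last by move=> j /bE.
by rewrite run_first // -P0.
Qed.

Section Walk.
Variables (w : seq A) (P : nat -> bits nbits) (z : seq B) (F : gV (ed z) -> gV (ed w) * C).
Hypothesis HF : outby (T := T) (g := ed w) (valuation P) (h := ed z) F.
Local Notation n := (size w).+1.
Local Notation beta := (bword w P).
Local Notation b := (annot fam beta n).
Local Notation pos s := (val (F s).1).

Lemma tape_annot i : tape b i.+1 =
  if i < n then Sym (beta i, pre fam beta i, suf fam beta n i.+1) else REnd.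
Proof.
rewrite tape_end; case: ltnP => Hi; first by rewrite drop_annot.
by rewrite drop_oversize // size_map size_iota.
Qed.

Lemma pos_lt s : pos s < n. Proof. exact: ltn_ord. Qed.

Lemma acc_end (e : bool) c (u : gV (ed w)) :
  acc (fam := fam) (iend e c) (suf fam beta n (val u).+1 (dlt true false (beta (val u)) (pre fam beta (val u))))
  <-> F (if e then ord_max else ord0) = (u, c).
Proof. by rewrite (sat_un fam) (fam_end HF). Qed.

Definition edge_at (u v : gV (ed w)) c d g := exists s s',
  [/\ F s = (u, c), F s' = (v, d) & gE (ed z) s g s'].

Lemma acc_eq c d g (u : gV (ed w)) :
  acc (fam := fam) (iedge c d g) (suf fam beta n (val u).+1 (dlt true true (beta (val u)) (pre fam beta (val u))))
  <-> edge_at u u c d g.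
Proof. by rewrite /edge_at -(fam_edge HF) -(sat_bin fam) eqxx. Qed.

Lemma acc_lt c d g (u v : gV (ed w)) : val u < val v ->
  acc (fam := fam) (iedge c d g) (suf fam beta n (val v).+1 (dlt false true (beta (val v)) (mid fam beta (val u) (val v))))
  <-> edge_at u v c d g.
Proof. by move=> uv; rewrite /edge_at -(fam_edge HF) -(sat_bin fam) (ltn_eqF uv) uv. Qed.

Lemma acc_gt c d g (u v : gV (ed w)) : val v < val u ->
  acc (fam := fam) (iedge c d g) (smid fam beta n (val v) (val u) (dlt false true (beta (val v)) (pre fam beta (val v))))
  <-> edge_at u v c d g.
Proof. by move=> vu; rewrite /edge_at -(fam_edge HF) -(sat_bin fam) (gtn_eqF vu) ltnNge (ltnW vu). Qed.

Lemma drop_onth (s : seq B) i g : onth s i = Some g -> drop i s = g :: drop i.+1 s.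
Proof. by elim: s i => [|x s IH] [|i] //=; [case=> ->; rewrite drop0|apply: IH]. Qed.

Lemma edge_drop s v d g z' : edge_at (F s).1 v (F s).2 d g ->
  (forall s', (F s').2 = d -> pos s' = val v -> z' = drop (val s') z) -> g :: z' = drop (val s) z.
Proof.
case=> s1 [s2 [E1 E2 Hg]] H; have Fi : injective F by case: HF.
have {E1} E1 : s1 = s by apply: Fi; rewrite E1; case: (F s).
move: Hg; rewrite {s1}E1 edE => /andP[/eqP Es /eqP Eg].
by rewrite (drop_onth Eg) (H s2) ?E2 // Es.
Qed.

(** What a successful run still has to write. A walking state is constrained only where its contents
    really come from a source node [s], since the induction starts at the end of the run and meets
    arbitrary configurations. No transition leaves a left walk at the left end marker, which gives
    [0 < c.2]. *)
Definition walk_inv (c : state * nat) (z' : seq B) : Prop :=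
  match c.1 with
  | Check _ => True
  | Back | Scan => z' = z
  | At a => forall s, (F s).2 = a -> (pos s).+1 = c.2 -> z' = drop (val s) z
  | WRight a _ _ q => forall s, (F s).2 = a -> (pos s).+1 < c.2 ->
      q = mid fam beta (pos s) c.2.-1 -> z' = drop (val s) z
  | WLeft a _ _ f => 0 < c.2 /\ forall s, (F s).2 = a -> c.2 <= pos s ->
      f = smid fam beta n c.2.-1 (pos s) -> z' = drop (val s) z
  | Fin => z' = [::]
  end.

(** Every test passed on the way refers to an actual edge of the output path, and a node has a
    single outgoing edge; hence the letters are forced. *)
Lemma mrun_inv_walk c z' : mrun2 b c z' -> walk_inv c z'.
Proof.
elim=> {c z'} [//|[p i] [q j] a z' [_ [e [/= Ht Hm _]]] _ IH].
case: i Ht Hm => [|i].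
  by case: p => //=; case: q IH => //= ->; case: a => //; case: e.
rewrite tape_annot; case: ltnP => Hi; last by case: p => // -[].
set u : gV (ed w) := Ordinal Hi.
case: p => //=.
- by case: q IH => // IH; case: a => //; case: e.
- case: q IH => //= [IH|c IH]; case: a => //; case: e => //.
  rewrite -[i]/(val u) => /(acc_end false) E /= Ej; rewrite Ej in IH.
  by rewrite (IH ord0) ?drop0 // E.
- move=> c; case: q IH => //= [d|c' d g q|c' d g f|] IH; (case: a => [g'|] //); case: e => //.
  + rewrite -[i]/(val u) => /acc_eq H /= Ej s Es [Ei]; rewrite Ej in IH.
    have Eu : (F s).1 = u by apply: val_inj.
    rewrite -Eu -Es in H; apply: (edge_drop H) => s' E1 E2.
    by apply: IH => //; rewrite E2 Eu.
  + move=> /andP[/eqP Ec /eqP Eq] /= Ej s Es [Ei]; rewrite Ej Ec Eq in IH; have {}Ei : pos s = i := Ei.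
    by apply: IH => //=; rewrite Ei // mid_first.
  + move=> /andP[/eqP Ec /eqP Ef] /= [Ej] s Es [Ei]; have {}Ei : pos s = i := Ei.
    case: IH => j0 IH; rewrite Ec Ef in IH.
    apply: IH => //; first by rewrite Ei Ej.
    case: j j0 Ej => // j _ Ej; rewrite Ei Ej smid_first -Ej //.
  + rewrite -[i]/(val u) => /(acc_end true) E /= _ s Es [Ei]; rewrite IH.
    have -> : s = ord_max.
      have Fi : injective F by case: HF.
      by apply: Fi; rewrite E -Es [LHS]surjective_pairing; congr (_, _); apply: val_inj.
    by rewrite drop_size.
- move=> c d g r; case: q IH => //= [d'|c' d' g' r'] IH; (case: a => [a|] //); case: e => //.
  + case/and3P=> /eqP Ed /eqP Eg; rewrite Eg => Ha /= Ej s Es Hs Er; rewrite Ej Ed in IH.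
    rewrite Er in Ha; have H := (@acc_lt c d g (F s).1 u Hs).1 Ha.
    rewrite -Es in H; apply: (edge_drop H) => s' E1 E2.
    by apply: IH => //; rewrite E2.
  + case/and4P=> /eqP Ec _ _ /eqP Er' /= Ej s Es Hs Er; rewrite Ej Ec Er' Er in IH.
    by apply: IH => //=; [rewrite ltnS ltnW|rewrite -mid_S].
- move=> c d g f; case: q IH => //= [d'|c' d' g' f'] IH; (case: a => [a|] //); case: e => //.
  + case/and3P=> /eqP Ed /eqP Eg; rewrite Eg => Ha /= Ej; split=> // s Es Hs Ef; rewrite Ej Ed in IH.
    rewrite Ef in Ha; have H := (@acc_gt c d g (F s).1 u Hs).1 Ha.
    rewrite -Es in H; apply: (edge_drop H) => s' E1 E2.
    by apply: IH => //; rewrite E2.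
  + case/and4P=> /eqP Ec _ _ /eqP Ef' /= [Ej]; split=> // s Es Hs Ef.
    case: IH => j0 IH; rewrite Ec Ef' Ef in IH.
    apply: IH => //; first by rewrite -Ej ltnW.
    case: j j0 Ej => // j _ Ej; rewrite Ej in Hs *.
    by rewrite [RHS]smid_P.
Qed.

Lemma mrun_step p i q o e j z' : p != Fin -> walker_tr p (tape b i) q o e -> moves i e j ->
  j <= n.+1 -> mrun2 b (q, j) z' -> mrun2 b (p, i) (oseq o ++ z').
Proof.
move=> pf Ht Hm Hj; apply: mrun_cons; split=> //; exists e; split=> //.
by rewrite size_map size_iota.
Qed.

Lemma mrun_walk_right c d g (u v : gV (ed w)) z' k : edge_at u v c d g -> val u < k -> k <= val v ->
  mrun2 b (At d, (val v).+1) z' -> mrun2 b (WRight c d g (mid fam beta (val u) k), k.+1) (g :: z').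
Proof.
move=> He uk kv Hr; have [m] := ubnP (val v - k); elim: m k uk kv => // m IH k uk.
have vn : val v < n by exact: ltn_ord.
rewrite leq_eqVlt => /predU1P[E _|kv Hm].
  rewrite -[g :: z']/(oseq (Some g) ++ z') E in uk *.
  apply: (mrun_step (e := MStay)) Hr => //; last by rewrite ltnS ltnW.
  by rewrite tape_annot vn /= !eqxx /=; apply/acc_lt.
rewrite -[g :: z']/(oseq None ++ (g :: z')).
apply: (mrun_step (e := MRight) (q := WRight c d g (mid fam beta (val u) k.+1)) (j := k.+2)) => //.
- by rewrite tape_annot (ltn_trans kv vn) /= !eqxx mid_S //= eqxx.
- by rewrite ltnS; apply: ltn_trans vn.
- by apply: IH => //; [apply: ltnW|apply: leq_trans (ltn_sub2l kv (ltnSn k)) _].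
Qed.

Lemma mrun_walk_left c d g (u v : gV (ed w)) z' k : edge_at u v c d g -> val v <= k -> k < val u ->
  mrun2 b (At d, (val v).+1) z' -> mrun2 b (WLeft c d g (smid fam beta n k (val u)), k.+1) (g :: z').
Proof.
move=> He vk ku Hr; have un : val u < n by exact: ltn_ord.
have vn : val v < n by exact: ltn_ord.
have stop : val v < val u -> mrun2 b (WLeft c d g (smid fam beta n (val v) (val u)), (val v).+1) (g :: z').
  move=> vu; rewrite -[g :: z']/(oseq (Some g) ++ z').
  apply: (mrun_step (e := MStay)) Hr => //; last by rewrite ltnS ltnW.
  by rewrite tape_annot vn /= !eqxx /=; apply/acc_gt.
elim: k vk ku => [|k IH] vk ku; first by move: vk stop; rewrite leqn0 => /eqP -> /(_ ku).
move: vk; rewrite leq_eqVlt => /predU1P[E|vk]; first by move: stop; rewrite E => /(_ ku).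
rewrite -[g :: z']/(oseq None ++ (g :: z')).
apply: (mrun_step (e := MLeft)) (IH vk (ltnW ku)) => //; last by rewrite ltnW // ltnS (ltn_trans (ltnW ku) un).
by rewrite tape_annot (ltn_trans ku un) /= !eqxx /= smid_P // eqxx.
Qed.

Lemma mrun_at s : mrun2 b (At (F s).2, (pos s).+1) (drop (val s) z).
Proof.
have [k] := ubnP (size z - val s); elim: k s => // k IH s Hk.
case: (ltngtP (val s) (size z)) (ltn_ord s) => [Hs _|H1 H2|Hs _].
- have [g Eg] := onth_size Hs; pose s' : gV (ed z) := Ordinal (Hs : (val s).+1 < (size z).+1).
  have Hr : mrun2 b (At (F s').2, (pos s').+1) (drop (val s).+1 z).
    by apply: (IH s'); apply: leq_trans (ltn_sub2l Hs (ltnSn _)) _.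
  have He : edge_at (F s).1 (F s').1 (F s).2 (F s').2 g.
    by exists s, s'; split; [case: (F s)|case: (F s')|rewrite edE /= Eg !eqxx].
  rewrite (drop_onth Eg).
  case: (ltngtP (pos s) (pos s')) => [lt|gt|eq].
  + rewrite -[g :: _]/(oseq None ++ (g :: _)).
    apply: (mrun_step (e := MRight)) (mrun_walk_right He (ltnSn _) lt Hr) => //.
      by rewrite tape_annot pos_lt /= mid_first !eqxx.
    by rewrite ltnS pos_lt.
  + rewrite -[g :: _]/(oseq None ++ (g :: _)).
    have H1 : val (F s').1 <= (pos s).-1 by rewrite -ltnS prednK // (leq_trans _ gt).
    have H2 : (pos s).-1 < pos s by rewrite prednK // (leq_trans _ gt).
    apply: (mrun_step (e := MLeft)) (mrun_walk_left He H1 H2 Hr) => //.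
    * by rewrite tape_annot pos_lt /= eqxx smid_pred ?eqxx // (leq_trans _ gt).
    * by rewrite /= prednK // (leq_trans _ gt).
    * exact: leq_ltn_trans (leq_pred _) (leqW (pos_lt s)).
  + rewrite -[g :: _]/(oseq (Some g) ++ _).
    apply: (mrun_step (e := MStay)) Hr => //.
      rewrite tape_annot pos_lt /=; apply/acc_eq.
      by have Eu : (F s).1 = (F s').1; [apply: val_inj|rewrite -Eu in He].
    by rewrite eq.
  exact: leqW (pos_lt s').
- by move: H2; rewrite ltnS leqNgt H1.
- have -> : s = ord_max by apply: val_inj.
  rewrite /= drop_size -[[::]]/(oseq (None : option B) ++ [::]).
  apply: (mrun_step (e := MStay)) (mrun_nil _ _ _ (pos ord_max).+1) => //.
    by rewrite tape_annot pos_lt /=; apply/(acc_end true); case: (F _).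
  by rewrite ltnS ltnW // pos_lt.
Qed.

Lemma mrun_scan i : i <= pos ord0 -> mrun2 b (Scan, i.+1) z.
Proof.
have [k] := ubnP (pos ord0 - i); elim: k i => // k IH i Hk.
rewrite leq_eqVlt => /predU1P[->|Hi]; rewrite -[z]/(oseq None ++ z).
  have := mrun_at ord0; rewrite drop0; apply: (mrun_step (e := MStay)) => //.
    by rewrite tape_annot pos_lt /=; apply/(acc_end false); case: (F _).
  by rewrite ltnS ltnW // pos_lt.
have H : i.+1 < n by apply: leq_trans (pos_lt ord0).
apply: (mrun_step (e := MRight) (j := i.+2)) (IH _ _ _) => //.
- by rewrite tape_annot (ltnW H).
- by rewrite ltnS ltnW.
- by apply: leq_trans (ltn_sub2l Hi (ltnSn i)) _.
Qed.

Lemma mrun_back i : i <= n -> mrun2 b (Back, i) z.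
Proof.
elim: i => [|i IH] Hi; rewrite -[z]/(oseq None ++ z).
  exact: (mrun_step (e := MRight)) (mrun_scan (leq0n _)).
apply: (mrun_step (e := MLeft)) (IH (ltnW Hi)) => //; last by rewrite ltnW // ltnW.
by rewrite tape_annot Hi.
Qed.

End Walk.

Definition walker : gsm G B := @machine G B state (Check None) Fin walker_tr.

Hypothesis T_string : forall w h, mso_rel T (ed w) h -> exists z, giso h (ed z).

(** Soundness needs an output path before anything is known about [z]: [T_string] provides it for
    the parameters read off [b], and the invariant then forces [z]. *)
Lemma walker_rel b z : gsm_rel walker b z <-> exists w (P : nat -> bits nbits),
  [/\ b = annot fam (bword w P) (size w).+1,
      sat (@asg0 (gV (ed w))) (valuation P) (phi_dom T)
    & exists F, outby (T := T) (g := ed w) (valuation P) (h := ed z) F].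
Proof.
rewrite /walker machine_rel.
transitivity (mrun2 b (Check None, 1) z).
  split=> [/mrun_inv[[]//|]|H].
    case=> -[q j] [a [z' [[_ [e [/=]]]]]].
    by case: q => // -[] //; case: a => //; case: e => // _ -> _ H ->.
  rewrite -[z]/(oseq None ++ z); apply: mrun_cons H.
  by split=> //; exists MRight.
rewrite mrun_check // drop0; split=> [[/valid_inv[w [P [-> Ha]]] Hr]|[w [P [-> Hd [F HF]]]]].
  have /sat_dom Hd := Ha; exists w, P; split=> //.
  have O := outgraphP T (valuation P (w := w)).
  have [z0 hz0] : exists z0, giso (outgraph T (valuation P (w := w))) (ed z0).
    by apply: (T_string (w := w)); exists (valuation P (w := w)); split=> //; apply/is_outputP; exists val.
  have [F HF] := outby_giso hz0 O.
  by have := mrun_inv_walk HF Hr; rewrite /walk_inv /= => ->; exists F.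
split; first by apply: valid_annot; apply/sat_dom.
by apply: (mrun_back HF); rewrite size_map size_iota.
Qed.

Lemma map_lab_annot w (P : nat -> bits nbits) :
  [seq x.1.1.1 | x <- annot fam (bword w P) (size w).+1] = None :: map Some w.
Proof.
rewrite -map_comp -[RHS](mkseq_nth None) /mkseq /= size_map; congr (_ :: _).
rewrite -[in LHS]addn1 -[in RHS]addn1; apply/eq_in_map => -[|i] //= _.
by rewrite onthE.
Qed.

(** The labels reveal [w] and the bits reveal the parameters; together they determine the output. *)
Lemma walker_functional b z z' : gsm_rel walker b z -> gsm_rel walker b z' -> z = z'.
Proof.
move=> /walker_rel[w [P [-> _ [F HF]]]] /walker_rel[w' [P' [Eb _ [F' HF']]]].
have Ew : w = w'.
  by have := congr1 (map (fun x : G => x.1.1.1)) Eb; rewrite !map_lab_annot => -[/(inj_map (@Some_inj _))].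
rewrite -{w'}Ew in Eb F' HF' *.
have EP : valuation P (w := w) = valuation P'.
  apply/funext => X; apply/funext => u; rewrite /valuation.
  have := congr1 (fun s => nth None (map (fun x : G => Some x.1.1.2) s) (val u)) Eb.
  by rewrite -!map_comp !(nth_map 0) ?size_iota ?ltn_ord // nth_iota ?ltn_ord // add0n => -[->].
rewrite -EP in HF'; exact/ed_inj/(outby_unique HF HF').
Qed.

(** All set variables of [T] are below [nbits], so truncating the parameters does not change
    satisfaction. *)
Lemma mso_rel_bits w z : mso_rel T (ed w) (ed z) <-> exists P : nat -> bits nbits,
  sat (@asg0 (gV (ed w))) (valuation P) (phi_dom T) /\
  exists F, outby (T := T) (g := ed w) (valuation P) (h := ed z) F.
Proof.
split=> [[nu [Hd /is_outputP[F [F1 F2 F3]]]]|[P [Hd HF]]]; last first.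
  by exists (valuation P); split=> //; apply/is_outputP.
pose P (i : nat) : bits nbits :=
  [ffun j : 'I_nbits => if (insub i : option 'I_(size w).+1) is Some u then nu j u else false].
have E X u : X < nbits -> valuation P X u = nu X u.
  move=> HX; rewrite /valuation /bit insubT ffunE insubT; first exact: ltn_ord.
  by move=> Hu; congr nu; apply: val_inj.
have S f nu1 : vb f <= nbits -> sat nu1 (valuation P) f <-> sat nu1 nu f.
  by move=> Hf; apply: sat_ext => // X HX u; apply: E; apply: leq_trans Hf.
have Sd : vb (phi_dom T) <= nbits by rewrite leq_maxl.
have Sn c : vb (phi_node T c tt) <= nbits.
  by rewrite !leq_max (leq_bigmax c) orbT.
have Se c d g : vb (phi_edge T c d g) <= nbits.
  by rewrite !leq_max (leq_bigmax (F := fun x : C * C * B => vb (phi_edge T x.1.1 x.1.2 x.2)) (c, d, g)) !orbT.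
exists P; split; first by apply/S.
by exists F; split=> // [u c|v v' g]; rewrite S.
Qed.

End Decomposition.

(** * The first machine: guessing the annotation in one pass *)

Section Relabel.
Variables (A G : finType) (lab : G -> option A).

(** The letter of the first node, which has no incoming edge, is written on the left end marker;
    this accounts for one letter more than in [w]. *)
Definition relabel_tr (p : bool) (s : tsym A) (q : bool) (o : option G) (e : dir) : bool :=
  match p, s, o, e with
  | false, LEnd, Some x, MRight => ~~ q && (lab x == None)
  | false, Sym a, Some x, MRight => ~~ q && (lab x == Some a)
  | false, REnd, None, MStay => q
  | _, _, _, _ => false
  end.

Definition relabeler : gsm A G := machine false true relabel_tr.

Lemma relabeler_fv : finite_visit relabeler.
Proof.
apply: oneway_fv => w c c' z /stepP[p [_ [|[_ -> -> _ _]]]]; last by rewrite addn0.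
case=> q [a [_ -> [_ [e [/= + Hm _]]]]].
case: p => //; case: (tape w c.2) => [||x]; case: a => [y|] //; case: e Hm => //= ->;
  by rewrite ?addn1 ?addn0.
Qed.

Lemma relabeler_rel w b : gsm_rel relabeler w b <-> map lab b = None :: map Some w.
Proof.
rewrite machine_rel.
have R i z : i <= size w -> mrun true relabel_tr w (false, i.+1) z <-> map lab z = map Some (drop i w).
  have [k] := ubnP (size w - i); elim: k i z => // k IH i z Hk Hi.
  case: (ltngtP i (size w)) Hi => // [Hi _|E _].
    have Hk' : size w - i.+1 < k by apply: leq_trans (ltn_sub2l Hi (ltnSn i)) _.
    have [x Ex] : exists x, drop i w = x :: drop i.+1 w.
      by case Ew: w Hi => [//|x0 w'] Hi; exists (nth x0 w i); rewrite -Ew (drop_nth x0) // Ew.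
    rewrite Ex; split=> [/mrun_inv[[]//|[[q j] [a [z' [[_ [e [Ht Hm _]]] Hr ->]]]]]|].
      move: Ht; rewrite [tape _ _]/= Ex.
      case: a Hr => [y|] //; case: e Hm => //= -> Hr /andP[Hq /eqP Hy].
      move: Hr; rewrite /= (negbTE Hq) => /(IH _ _ Hk' Hi) Ez'.
      by rewrite /= Hy Ez'.
    case: z => // y z [Hy Hz]; rewrite -[y :: z]/(oseq (Some y) ++ z).
    apply: (mrun_cons (c' := (false, i.+2))); last exact/(IH _ _ Hk' Hi).
    by split=> //; exists MRight; rewrite [tape _ _]/= Ex /= Hy eqxx.
  rewrite E drop_size; split=> [/mrun_inv[[]//|[[q j] [a [z' [[_ [e [Ht Hm _]]] Hr ->]]]]]|].
    move: Ht; rewrite [tape _ _]/= drop_size.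
    case: a Hr => [y|] //; case: e Hm => //= -> Hr Hq; rewrite Hq in Hr.
    by case/mrun_inv: Hr => [[_ ->]|[? [? [? [[]]]]]].
  case: z => // _; rewrite -[[::]]/(oseq (None : option G) ++ [::]).
  apply: (mrun_cons (c' := (true, (size w).+1))); last by constructor.
  by split=> //; exists MStay; rewrite [tape _ _]/= drop_size.
split=> [/mrun_inv[[]//|[[q j] [a [z' [[_ [e [Ht Hm _]]] Hr ->]]]]]|].
  move: Ht; rewrite [tape _ _]/=.
  case: a Hr => [y|] //; case: e Hm => //= -> Hr /andP[Hq /eqP Hy].
  by move: Hr; rewrite (negbTE Hq) R // drop0 /= Hy => ->.
case: b => // y z [Hy Hz]; rewrite -[y :: z]/(oseq (Some y) ++ z).
apply: (mrun_cons (c' := (false, 1))); last by apply/R; rewrite ?drop0.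
by split=> //; exists MRight; rewrite /= Hy.
Qed.

End Relabel.

Theorem theorem6p5 (S1 S3 : finType) (m : seq S1 -> seq S3 -> Prop) :
  NMSO_ed m <->
  exists (S2 : finType) (m1 : strans S1 S2) (m2 : strans S2 S3),
    [/\ NGSM_fv m1, NGSM_fv m2 & forall w z, m w z <-> rcomp m1 m2 w z].
Proof.
split=> [|[S2 [m1 [m2 [H1 H2 H]]]]]; last first.
  apply/string_mso_NMSO/(string_mso_ext (fun w z => iff_sym (H w z))).
  by apply: string_mso_comp; apply: NGSM_fv_string_mso.
case=> T [H1 H2].
have T_string w h : mso_rel T (ed w) h -> exists z, giso h (ed z).
  by case/H2 => _ [z [_ _ hz]]; exists z.
have mT w z : m w z <-> mso_rel T (ed w) (ed z).
  by split=> [/H1//|/H2[w' [z' [mw /ed_inj -> /ed_inj ->]]]].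
exists (base S1 (nbits T) * St (@fam _ _ T) * {ffun St (@fam _ _ T) -> St (@fam _ _ T)})%type.
exists (gsm_rel (relabeler (fun x => x.1.1.1))), (gsm_rel (walker T)); split.
- by exists (relabeler (fun x => x.1.1.1)); split=> //; apply: relabeler_fv.
- by exists (walker T); split=> //; apply: functional_fv => b z z'; apply: walker_functional.
- move=> w z; rewrite mT mso_rel_bits; split=> [[P [Hd HF]]|[b [/relabeler_rel Hb]]].
    exists (annot (@fam _ _ T) (bword w P) (size w).+1); split.
      by apply/relabeler_rel; apply: map_lab_annot.
    by apply/walker_rel => //; exists w, P.
  case/(walker_rel T_string) => w' [P [Eb Hd HF]].
  (* Both machines see the same labels on the intermediate word. *)
  have Ew : w' = w by move: Hb; rewrite Eb map_lab_annot => -[/(inj_map (@Some_inj _))].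
  by rewrite -Ew; exists P.
Qed.
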